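(* Fix $q\in[0,2)$ and $R>0$. There exists a positive constant $C_3>0$ such that for all $n,p$ with $2\log p<n$ and $R^2<(p-1)n^{-q}/2$, $$\inf_{\hat Q}\ \sup_{\Sigma\in\mathcal{F}_q(R)}\ \mathbb{E}_\Sigma\Big[\big(\hat Q-Q(\Sigma)\big)^2\Big]\ \ge\ C_3\,\phi_{n,p}(q,R),$$ where $$\phi_{n,p}(q,R)=\frac{R^2}{n}\ \vee\ \left\{R^2\left(\frac{\log\big(\frac{p-1}{R^2n^q}+1\big)}{2n}\right)^{2-q}\wedge R^{4/q}\wedge 1\right\},$$ and the infimum is taken over all measurable functions $\hat Q$ of the sample $X_1,\dots,X_n$.
   Context: $a\vee b=\max(a,b)$, $a\wedge b=\min(a,b)$; $n,p$ are positive integers. $\mathbf{S}_p^+$ is the set of $p\times p$ real symmetric positive semi-definite matrices. For $q\in[0,2)$, $R>0$, $$\mathcal{F}_q(R)=\Big\{\Sigma=(\sigma_{ij})\in\mathbf{S}_p^+:\ \sum_{i\ne j}|\sigma_{ij}|^q\le R,\ \mathrm{diag}(\Sigma)=I_p\Big\},$$ where $\mathrm{diag}(\Sigma)$ is $\Sigma$ with off-diagonal entries set to $0$, the sum is over ordered pairs $i\neq j$, and for $q=0$, $|x|^0$ means $1$ if $x\ne0$ and $0$ if $x=0$. $Q(\Sigma)=\sum_{i\neq j}\sigma_{ij}^2$. The sample $X_1,\dots,X_n$ consists of i.i.d. $\mathcal{N}(0,\Sigma)$ vectors in $\mathbb{R}^p$ and $\mathbb{E}_\Sigma$ is the expectation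 under this law.
   Formalization: For q=0 the formal theorem assumes R≥2: if q=0 and R<2, symmetry forces F_0(R)={I_p}, so the minimax risk is 0 while φ≥R²/n>0 and the claim fails. At q=0, R^{4/q} is read as its limit (+∞ for R>1). *)

(* Defs.v *)
From HB Require Import structures.
From mathcomp Require Import all_boot all_order all_algebra.
From mathcomp Require Import all_classical all_reals all_analysis.

Set Implicit Arguments.
Unset Strict Implicit.
Unset Printing Implicit Defensive.

Import Order.TTheory GRing.Theory Num.Theory.
Import numFieldNormedType.Exports.

Local Open Scope classical_set_scope.
Local Open Scope ring_scope.

(* [powR x 0 = 1] for every [x], including [x = 0], whereas here [|0|^0 = 0]. *)
Definition abs_pow (R : realType) (q x : R) : R :=
  if q == 0 then (x != 0)%:R else `|x| `^ q.

Definition psd (R : realType) (p : nat) (S : 'M[R]_p) : Prop :=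
  S^T = S /\ forall u : 'cV[R]_p, 0 <= (u^T *m S *m u) ord0 ord0.

Definition sparse_corr (R : realType) (p : nat) (q r : R) : set 'M[R]_p :=
  [set S | [/\ psd S,
               \sum_(i < p) \sum_(j < p | j != i) abs_pow q (S i j) <= r &
               forall i, S i i = 1]].

Definition offdiag_sq (R : realType) (p : nat) (S : 'M[R]_p) : R :=
  \sum_(i < p) \sum_(j < p | j != i) S i j ^+ 2.

(* Joint law of [n] independent variables, each with law [mu]: the values on
   measurable boxes determine [P], since boxes generate the sigma-algebra. *)
Definition iid_law (R : realType) (d : measure_display) (T : measurableType d)
    (n : nat) (mu : set T -> \bar R) (P : probability (n.-tuple T) R) : Prop :=
  forall A : 'I_n -> set T, (forall i, measurable (A i)) ->
    P [set x | forall i, A i (tnth x i)] = (\prod_(i < n) mu (A i))%E.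

Definition mulmx_tuple (R : realType) (p : nat) (A : 'M[R]_p)
    (z : p.-tuple R) : p.-tuple R :=
  [tuple (A *m \col_j tnth z j) i ord0 | i < p].

(* [mu] is N(0, S): the law of [A Z] with [A A^T = S] and [Z] standard normal
   in R^p. It does not depend on the choice of [A], and [S] may be singular. *)
Definition gaussian_law (R : realType) (p : nat) (S : 'M[R]_p)
    (mu : probability (p.-tuple R) R) : Prop :=
  exists (A : 'M[R]_p) (gamma : probability (p.-tuple R) R),
    [/\ A *m A^T = S,
        iid_law (T := R) (normal_prob 0 1) gamma &
        forall B : set (p.-tuple R), measurable B ->
          mu B = gamma (mulmx_tuple A @^-1` B)].

Definition gaussian_sample (R : realType) (n p : nat) (S : 'M[R]_p)
    (P : probability (n.-tuple (p.-tuple R)) R) : Prop :=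
  exists mu : probability (p.-tuple R) R, gaussian_law S mu /\ iid_law mu P.

(* The law [P] is determined by [S]; taking the supremum over the pairs
   [(S, P)] is therefore the supremum over [S] of the risk under [S]. *)
Definition max_risk (R : realType) (n p : nat) (q r : R)
    (Qhat : n.-tuple (p.-tuple R) -> R) : \bar R :=
  ereal_sup [set e | exists (S : 'M[R]_p)
                            (P : probability (n.-tuple (p.-tuple R)) R),
    [/\ sparse_corr q r S, gaussian_sample S P &
        e = (\int[P]_x ((Qhat x - offdiag_sq S) ^+ 2)%:E)%E]].

Definition minimax_risk (R : realType) (n p : nat) (q r : R) : \bar R :=
  ereal_inf [set max_risk q r Qhat |
    Qhat in [set Qhat : n.-tuple (p.-tuple R) -> R | measurable_fun setT Qhat]].

(* [r^(4/q)], extended to [q = 0] by its limit as [q] decreases to 0. *)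
Definition pow_4_div (R : realType) (q r : R) : \bar R :=
  if q == 0 then (if 1 < r then +oo%E else ((r == 1)%:R)%:E)
  else (r `^ (4 / q))%:E.

Definition phi_rate (R : realType) (n p : nat) (q r : R) : \bar R :=
  let n' : R := n%:R in
  let L : R := ln ((p%:R - 1) / (r ^+ 2 * n' `^ q) + 1) in
  maxe (r ^+ 2 / n')%:E
       (mine (mine (r ^+ 2 * (L / (2 * n')) `^ (2 - q))%:E (pow_4_div q r))
             1%E).

(* The sum of the [|S i j|^0] over [i != j] is an even integer, by symmetry. *)
Lemma sparse_corr0_lt2 (R : realType) (p : nat) (r : R) (S : 'M[R]_p) :
  r < 2 -> sparse_corr 0 r S -> S = 1%:M.
Proof.
move=> r2 [[Ssym _] Sle Sdiag]; apply/matrixP => i j; rewrite mxE.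
have [->|ij] := eqVneq i j; first by rewrite Sdiag.
apply/eqP/negPn/negP => Sij.
have Sji : S j i != 0 by rewrite -Ssym mxE.
have ge0 (k l : 'I_p) : 0 <= abs_pow 0 (S k l).
  by rewrite /abs_pow eqxx ler0n.
have row (k l : 'I_p) : l != k -> S k l != 0 ->
    1 <= \sum_(m < p | m != k) abs_pow 0 (S k m).
  move=> lk Skl; rewrite (bigD1 l)//= {1}/abs_pow eqxx Skl lerDl.
  by apply: sumr_ge0 => m _; exact: ge0.
suff : 2 <= r by rewrite leNgt r2.
have ji : j != i by rewrite eq_sym.
apply: le_trans Sle; rewrite (bigD1 i)//= -[2]/(1 + 1).
apply: lerD; first exact: (row i j).
rewrite (bigD1 j)//= -[leLHS]addr0; apply: lerD; first exact: (row j i).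
by apply: sumr_ge0 => k _; apply: sumr_ge0 => l _; exact: ge0.
Qed.

(* Main.v *)
(* Both terms of the rate come from comparing a law P_0 with a mixture of laws
   P_e having the same value of Q, through the chi-square distance (lemma
   [le_cam]).  The covariances are stars: the coordinates are split into k
   centres and m leaves, every leaf i is attached to a centre l i, and one leaf
   e j of each centre j is correlated with it, with coefficient rho; then
   Q = 2 k rho^2 and the sum of the |sigma_ij|^q is 2 k rho^q.  Conditionally on
   the centres, the leaves are independent one-dimensional Gaussians, so
   likelihood ratios with respect to N(0, I_p) are products of one-dimensional
   ones, and the chi-square factorizes over the centres: against rho = 0 each
   centre where e and e' agree contributes (1 - rho^2)^(-n), the others 1.

   The term r^2 / n is the two-point bound with one star, rho and
   rho - rho / (2 sqrt n).  For the other term, the leaves form k blocks of size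
   b of order p / k and e is uniform among the choices of one leaf in each block:
   with V = (1 - rho^2)^(-n), the second moment of the likelihood ratio is
   (1 + (V - 1) / b)^k, which is bounded when rho^2 is a small multiple of L / n
   and k of r rho^(-q).  No centre has two correlated leaves, so that these
   matrices are positive semi-definite as soon as rho < 1. *)

Require Import Defs.
From mathcomp Require Import all_boot all_order all_algebra.
From mathcomp Require Import all_classical all_reals all_analysis.
From mathcomp Require Import measurable_realfun ring lra.
From HB Require Import structures.

Import Order.TTheory GRing.Theory Num.Theory.
Import numFieldNormedType.Exports.

Set Implicit Arguments.
Unset Strict Implicit.
Unset Printing Implicit Defensive.

Local Open Scope classical_set_scope.
Local Open Scope ring_scope.

(** * Product laws and Gaussian densities *)

Section density.
Local Open Scope ereal_scope.
Context d (T : measurableType d) (R : realType).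
Import HBNNSimple.

(** Approximating [f] from below by simple functions reduces this to indicators, where it is the
    hypothesis on [nu]. *)
Lemma ge0_integral_density (mu nu : {measure set T -> \bar R}) (g : T -> R)
    (f : T -> \bar R) :
  (forall x, 0 <= g x)%R -> measurable_fun [set: T] g ->
  (forall A, measurable A -> nu A = \int[mu]_(x in A) (g x)%:E) ->
  (forall x, 0 <= f x) -> measurable_fun [set: T] f ->
  \int[nu]_x f x = \int[mu]_x (f x * (g x)%:E).
Proof.
move=> g0 mg nuE f0 mf.
pose h := nnsfun_approx measurableT mf.
have hf x : (EFin \o h n) x @[n --> \oo] --> f x.
  exact: cvg_nnsfun_approx.
have ndh x : {homo (fun n => (EFin \o h n) x) : a b / (a <= b)%N >-> a <= b}.
  by move=> a b ab; rewrite lee_fin; exact/lefP/nd_nnsfun_approx.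
have -> : \int[nu]_x f x = lim (\int[nu]_x (EFin \o h n) x @[n --> \oo]).
  under eq_integral => x _ do rewrite -(cvg_lim (@ereal_hausdorff R) (hf x)).
  apply: monotone_convergence => //.
  - by move=> n; exact/measurable_EFinP.
  - by move=> n x _ //=; rewrite lee_fin.
have -> : \int[mu]_x (f x * (g x)%:E) =
    lim (\int[mu]_x ((EFin \o h n) x * (g x)%:E) @[n --> \oo]).
  have fg x : f x * (g x)%:E = lim ((EFin \o h n) x * (g x)%:E @[n --> \oo]).
    by apply/esym/cvg_lim => //; exact: cvgeZr.
  under eq_integral => x _ do rewrite fg.
  apply: monotone_convergence => //.
  - move=> n; apply: emeasurable_funM; exact/measurable_EFinP.
  - by move=> n x _ /=; rewrite mule_ge0 ?lee_fin.
  - by move=> x _ a b ab; rewrite lee_wpmul2r ?lee_fin//; exact: ndh.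
congr (lim _); apply: (@congr1 _ _ (fun u : nat -> \bar R => u @ \oo)).
apply/funext => n.
have mhn r : measurable (h n @^-1` [set r]) by exact: measurable_sfunP.
transitivity (\int[nu]_x (\sum_(y \in range (h n)) (y * \1_(h n @^-1` [set y]) x)%:E)).
  by apply: eq_integral => x _; rewrite /= fimfunE -fsumEFin.
transitivity (\int[mu]_x (\sum_(y \in range (h n))
    ((y * \1_(h n @^-1` [set y]) x)%:E * (g x)%:E))); last first.
  apply: eq_integral => x _ /=; rewrite [in RHS]fimfunE -fsumEFin//.
  by rewrite ge0_mule_fsuml// => y; rewrite nnfun_muleindic_ge0.
rewrite ge0_integral_fsum//; last 2 first.
  - by move=> y; exact/measurable_EFinP/measurable_funM.
  - by move=> y x _; rewrite nnfun_muleindic_ge0.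
rewrite ge0_integral_fsum//; last 2 first.
  - move=> y; apply/measurable_EFinP/measurable_funM => //.
    exact: measurable_funM.
  - by move=> y x _; rewrite mule_ge0// ?nnfun_muleindic_ge0 ?lee_fin.
apply: eq_fsbigr => y; rewrite inE => -[z _ yE].
have y0 : (0 <= y)%R by rewrite -yE.
under eq_integral do rewrite EFinM.
rewrite ge0_integralZl//; last first.
  exact/measurable_EFinP.
rewrite integral_indic// setIT nuE//.
under [RHS]eq_integral do rewrite EFinM -muleA.
rewrite ge0_integralZl//; last 2 first.
  - apply: emeasurable_funM; last exact/measurable_EFinP.
    exact/measurable_EFinP.
  - by move=> x _; rewrite mule_ge0 ?lee_fin.
congr (_ * _); rewrite integral_mkcond; apply: eq_integral => x _.
rewrite /patch indicE; case: ifP => _; by rewrite ?mul1e ?mul0e.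
Qed.

End density.

Section std_normal.
Context (R : realType).

Definition borel_id : measurableTypeR R -> R := idfun.

HB.instance Definition _ :=
  @isMeasurableFun.Build _ _ _ _ borel_id (@measurable_id _ _ setT).

(* [normal_prob 0 1] lives on [measurableTypeR R], whose display differs from
   the default one of [R]. *)
Definition std_normal : probability R R := distribution (normal_prob 0 1) borel_id.

End std_normal.

(** * One-dimensional Gaussian integrals *)

Section gaussian_integrals.
Context (R : realType).
Local Open Scope ereal_scope.
Local Notation leb := (@lebesgue_measure R).
Local Notation N01 := (std_normal R).

Lemma ge0_measurable_funV d (T : measurableType d) (f : T -> R) :
  (forall x, 0 <= f x)%R -> measurable_fun [set: T] f ->
  measurable_fun [set: T] (fun x => (f x)^-1)%R.
Proof.
move=> f0 mf; under eq_fun do rewrite -powR_inv1//.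
by have := measurableT_comp (@measurable_powR R (-1)%R) mf.
Qed.

Definition normal_lr (a s x : R) : R := (normal_pdf a s x / normal_pdf 0 1 x)%R.

Lemma normal_lr_ge0 (a s x : R) : (0 <= normal_lr a s x)%R.
Proof. by rewrite divr_ge0 ?normal_pdf_ge0. Qed.

Lemma measurable_normal_lr (a s : R) : measurable_fun [set: R] (normal_lr a s).
Proof.
apply: measurable_funM; first exact: measurable_normal_pdf.
apply: ge0_measurable_funV; first exact: normal_pdf_ge0.
exact: measurable_normal_pdf.
Qed.

Lemma normal_lrE (a s x : R) : (0 < s)%R ->
  normal_lr a s x = (s^-1 * expR (x ^+ 2 / 2 - (x - a) ^+ 2 / (2 * s ^+ 2)))%R.
Proof.
move=> s0; rewrite /normal_lr !normal_pdfE ?oner_eq0 ?gt_eqF//.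
rewrite /normal_peak /normal_fun expr1n mul1r subr0.
rewrite -(mulrnAr (s ^+ 2)) sqrtrM ?sqr_ge0// sqrtr_sqr gtr0_norm//.
set P := Num.sqrt _.
have P0 : (P != 0)%R by rewrite gt_eqF// sqrtr_gt0 mulrn_wgt0// pi_gt0.
rewrite [((P^-1 * _)^-1)%R]invfM invrK -expRN mulrACA -expRD invfM -(mulrA (s^-1)%R) mulVf// mulr1.
congr (_ * expR _)%R; field; exact: lt0r_neq0.
Qed.

Lemma normal_pdf_gt0 (a s x : R) : s != 0%R -> (0 < normal_pdf a s x)%R.
Proof.
by move=> s0; rewrite normal_pdfE// mulr_gt0 ?normal_peak_gt0 ?expR_gt0.
Qed.

Lemma ge0_integral_std_normal (f : R -> \bar R) :
  (forall x, 0 <= f x) -> measurable_fun [set: R] f ->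
  \int[N01]_x f x = \int[leb]_x (f x * (normal_pdf 0 1 x)%:E).
Proof.
move=> f0 mf; rewrite ge0_integral_distribution//.
apply: (ge0_integral_density (mu := leb)) => //.
- exact: normal_pdf_ge0.
- exact: measurable_normal_pdf.
Qed.

(** The image of Lebesgue measure under the affine map, multiplied by [s], gives each half-open
    interval its length; uniqueness of Lebesgue measure concludes. *)
Lemma ge0_integral_lebesgue_affine (a s : R) (f : R -> \bar R) : (0 < s)%R ->
  (forall x, 0 <= f x) -> measurable_fun [set: R] f ->
  \int[leb]_x f x = s%:E * \int[leb]_x f (a + s * x)%R.
Proof.
move=> s0 f0 mf.
pose phi : measurableTypeR R -> measurableTypeR R := fun x => (a + s * x)%R.
have mphi : measurable_fun setT phi.
  by apply: measurable_funD => //; exact: measurable_funM.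
have [nu nuE ->] : exists2 nu : {measure set (measurableTypeR R) -> \bar R},
    (forall A, nu A = s%:E * leb (phi @^-1` A)) &
    s%:E * \int[leb]_x f (a + s * x)%R = \int[nu]_x f x.
  unshelve eexists (mscale (NngNum (ltW s0)) (pushforward leb phi)) => //.
  by rewrite ge0_integral_mscale// ge0_integral_pushforward.
apply: eq_measure_integral => A mA _.
apply: (@lebesgue_measure_unique R nu) => // _ [[b c]] _ <- /=.
rewrite nuE.
have -> : phi @^-1` `]b, c]%classic = `]((b - a) / s)%R, ((c - a) / s)%R]%classic.
  apply/seteqP; split => x /=; rewrite !in_itv/= /phi ltr_pdivrMr// ler_pdivlMr//;
    by rewrite ltrBlDl lerBrDl mulrC.
rewrite !lebesgue_measure_itv/= !lte_fin ltr_pM2r ?invr_gt0// ltrD2r.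
case: ifPn => _; last by rewrite mule0.
rewrite -!EFinB -EFinM; congr (_%:E); field; exact: lt0r_neq0.
Qed.

(** Moved to Lebesgue measure, the two integrals differ by an affine substitution. Thus
    [normal_lr a s] is the density of the law of a + s Z relative to that of a standard normal Z. *)
Lemma ge0_integral_normal_affine (a s : R) (f : R -> \bar R) : (0 < s)%R ->
  (forall x, 0 <= f x) -> measurable_fun [set: R] f ->
  \int[N01]_x f (a + s * x)%R = \int[N01]_x (f x * (normal_lr a s x)%:E).
Proof.
move=> s0 f0 mf.
have mphi : measurable_fun [set: R] (fun x : R => (a + s * x)%R).
  by apply: measurable_funD => //; exact: measurable_funM.
have mpdf b t : measurable_fun [set: R] (fun x => (normal_pdf b t x)%:E).
  by apply/measurable_EFinP; exact: measurable_normal_pdf.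
rewrite ge0_integral_std_normal//; last exact: measurableT_comp mf mphi.
rewrite ge0_integral_std_normal//; last 2 first.
- by move=> x; rewrite mule_ge0// lee_fin normal_lr_ge0.
- by apply: emeasurable_funM => //; apply/measurable_EFinP; exact: measurable_normal_lr.
under [RHS]eq_integral => x _.
  rewrite -muleA -EFinM divfK; last by rewrite gt_eqF// normal_pdf_gt0 ?oner_eq0.
  over.
rewrite [RHS](@ge0_integral_lebesgue_affine a s)//; last 2 first.
- by move=> x; rewrite mule_ge0// lee_fin normal_pdf_ge0.
- exact: emeasurable_funM.
rewrite -ge0_integralZl//; last 3 first.
- have := measurableT_comp (emeasurable_funM mf (mpdf a s)) mphi.
  exact.
- by move=> x _; rewrite mule_ge0// lee_fin normal_pdf_ge0.
- by rewrite lee_fin ltW.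
apply: eq_integral => x _.
rewrite muleCA -EFinM; congr (_ * _%:E).
rewrite !normal_pdfE ?oner_eq0 ?gt_eqF// /normal_peak /normal_fun.
rewrite expr1n mul1r subr0 [(a + _)%R]addrC addrK.
rewrite -(mulrnAr (s ^+ 2)) sqrtrM ?sqr_ge0// sqrtr_sqr gtr0_norm// invfM.
rewrite !mulrA mulfV ?gt_eqF// mul1r; congr (_ * expR _)%R.
field; exact: lt0r_neq0.
Qed.

Lemma integral_normal_lr (a s : R) : (0 < s)%R ->
  \int[N01]_y (normal_lr a s y)%:E = 1.
Proof.
move=> s0; transitivity (\int[N01]_y (cst 1 y * (normal_lr a s y)%:E)).
  by apply: eq_integral => x _; rewrite mul1e.
rewrite -ge0_integral_normal_affine//.
by rewrite integral_cst//= probability_setT mul1e.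
Qed.

(** Completing the square makes the integrand a constant times [normal_lr] of mean b / (1 + c) and
    variance 1 / (1 + c), whose integral is 1. *)
Lemma integral_normal_expR_quad (b c : R) : (0 < 1 + c)%R ->
  \int[N01]_y (expR (b * y - c * y ^+ 2 / 2))%:E =
  ((Num.sqrt (1 + c))^-1 * expR (b ^+ 2 / (2 * (1 + c))))%:E.
Proof.
move=> c0.
set s : R := ((Num.sqrt (1 + c))^-1)%R; set a := (b / (1 + c))%R.
have s0 : (0 < s)%R by rewrite invr_gt0 sqrtr_gt0.
have s2 : (s ^+ 2 = (1 + c)^-1)%R by rewrite exprVn sqr_sqrtr// ltW.
have H := integral_normal_lr a s0.
rewrite (_ : (fun y => (normal_lr a s y)%:E) =
   (fun y => (s^-1 * expR (- (b ^+ 2 / (2 * (1 + c)))))%:E *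
             (expR (b * y - c * y ^+ 2 / 2))%:E)) in H; last first.
  apply/funext => y; rewrite -EFinM normal_lrE// -(mulrA (s^-1)%R) -expRD.
  congr (_ * expR _)%:E.
  rewrite s2 /a; field; by rewrite gt_eqF.
have k0 : (0 < s^-1 * expR (- (b ^+ 2 / (2 * (1 + c)))))%R.
  by apply: mulr_gt0; [rewrite invr_gt0; exact: s0|exact: expR_gt0].
move: H; set k := (s^-1 * _)%R in k0 *; rewrite ge0_integralZl//; last 2 first.
- apply/measurable_EFinP; apply: measurableT_comp => //.
  apply: measurable_funB; first exact: measurable_funM.
  by apply: measurable_funM => //; apply: measurable_funM => //; exact: measurable_funX.
- by rewrite lee_fin ltW.
set I := integral _ _ _ => H.
have -> : I = (k^-1)%:E * 1.
  by rewrite -H muleA -EFinM mulVf ?gt_eqF// mul1e.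
by rewrite mule1 invfM invrK expRN invrK.
Qed.

End gaussian_integrals.

(** * Finite product measures *)

Section iid_prob.
Local Open Scope ereal_scope.
Context d (T : measurableType d) (R : realType).

Definition cons_pair n (x : T * n.-tuple T) : n.+1.-tuple T :=
  [tuple of x.1 :: x.2].

Lemma measurable_cons_pair n : measurable_fun [set: T * n.-tuple T] (@cons_pair n).
Proof. exact: measurable_cons. Qed.

HB.instance Definition _ n := @isMeasurableFun.Build _ _ _ _ (@cons_pair n)
  (@measurable_cons_pair n).

Variable mu : probability T R.

Fixpoint iid_prob n : probability (n.-tuple T) R :=
  match n with
  | 0 => \d_([tuple] : 0.-tuple T)
  | m.+1 => distribution (mu \x iid_prob m) (@cons_pair m)
  end.


Lemma ge0_integral_iid_probS n (f : n.+1.-tuple T -> \bar R) :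
  (forall x, 0 <= f x) -> measurable_fun [set: n.+1.-tuple T] f ->
  \int[iid_prob n.+1]_x f x =
  \int[mu]_x \int[iid_prob n]_t f [tuple of x :: t].
Proof.
move=> f0 mf; rewrite /= ge0_integral_distribution//.
rewrite fubini_tonelli1//; last by move=> x; exact: f0.
exact: measurableT_comp mf (@measurable_cons_pair n).
Qed.

Lemma integral_iid_prob0 (f : 0.-tuple T -> \bar R) : \int[iid_prob 0]_x f x = f [tuple].
Proof.
have -> : f = cst (f [tuple]) by apply/funext => x; rewrite (tuple0 x).
by rewrite integral_cst//= diracT mule1.
Qed.

Lemma measurable_integral_iid_prob n (f : n.+1.-tuple T -> \bar R) :
  (forall x, 0 <= f x) -> measurable_fun [set: n.+1.-tuple T] f ->
  measurable_fun [set: T] (fun x => \int[iid_prob n]_t f [tuple of x :: t]).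
Proof.
move=> f0 mf.
apply: (measurable_fun_fubini_tonelli_F (f \o @cons_pair n)).
  exact: measurableT_comp mf (@measurable_cons_pair n).
by move=> x; exact: f0.
Qed.

Lemma measurable_cons_tuple n (x : T) :
  measurable_fun [set: n.-tuple T] (fun t => [tuple of x :: t] : n.+1.-tuple T).
Proof. exact: measurable_cons. Qed.

Lemma measurable_forall_tnth n (A : 'I_n -> set T) : (forall i, measurable (A i)) ->
  measurable [set x : n.-tuple T | forall i, A i (tnth x i)].
Proof.
move=> mA.
rewrite (_ : [set _ | _] = \bigcap_(i in [set: 'I_n]) ((@tnth _ T ^~ i) @^-1` A i)).
  apply: fin_bigcap_measurable => // i _.
  by rewrite -[X in measurable X]setTI; exact: measurable_tnth.
by apply/seteqP; split => x /= h i; [move=> _|]; exact: h.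
Qed.

Lemma iid_law_iid_prob n : iid_law mu (iid_prob n).
Proof.
elim: n => [|n IH] A mA.
  rewrite big_ord0 [X in iid_prob 0 X](_ : _ = setT) ?probability_setT//.
  by apply/seteqP; split => // x _ [].
rewrite big_ord_recl/= -(IH (fun i => A (lift ord0 i)))//.
rewrite -product_measure1E//; last exact: (@measurable_forall_tnth _ (fun i => A (lift ord0 i))).
rewrite /distribution /pushforward; congr (_ _).
apply/seteqP; split => -[x t]/=.
  by move=> h; split; [have := h ord0|move=> i; have := h (lift ord0 i)]; rewrite ?tnthS.
move=> [h0 h] i; case: (unliftP ord0 i) => [j ->|->]; first by rewrite tnthS.
by rewrite tnth0.
Qed.

Lemma measurable_prod_tnth n (h : 'I_n -> T -> R) :
  (forall i, measurable_fun [set: T] (h i)) ->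
  measurable_fun [set: n.-tuple T] (fun t => \prod_(i < n) h i (tnth t i))%R.
Proof.
move=> mh; apply: measurable_prod => i _.
exact: measurableT_comp (mh i) (measurable_tnth i).
Qed.

Lemma ge0_integral_iid_prob_prod n (h : 'I_n -> T -> R) :
  (forall i x, 0 <= h i x)%R -> (forall i, measurable_fun [set: T] (h i)) ->
  \int[iid_prob n]_t (\prod_(i < n) h i (tnth t i))%:E =
  \prod_(i < n) \int[mu]_x (h i x)%:E.
Proof.
elim: n h => [|n IH] h h0 mh; first by rewrite integral_iid_prob0 !big_ord0.
rewrite ge0_integral_iid_probS//; last 2 first.
- by move=> x; rewrite lee_fin prodr_ge0.
- by apply/measurable_EFinP; exact: measurable_prod_tnth.
rewrite [RHS]big_ord_recl -(IH (fun i => h (lift ord0 i)))//.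
set c := integral (iid_prob n) _ _.
rewrite -ge0_integralZr//; last 3 first.
- exact/measurable_EFinP.
- by move=> x _; rewrite lee_fin.
- by apply: integral_ge0 => t _; rewrite lee_fin prodr_ge0.
apply: eq_integral => x _.
rewrite -ge0_integralZl//; last 3 first.
- by apply/measurable_EFinP; exact: (@measurable_prod_tnth _ (fun i => h (lift ord0 i))).
- by move=> t _; rewrite lee_fin prodr_ge0.
- by rewrite lee_fin.
apply: eq_integral => t _; rewrite -EFinM big_ord_recl tnth0.
by congr (_ * _)%:E; apply: eq_bigr => i _; rewrite tnthS.
Qed.

End iid_prob.

Section iid_prob_change.
Local Open Scope ereal_scope.
Context d d' (T : measurableType d) (T' : measurableType d') (R : realType).
Variables (mu : probability T R) (mu' : probability T' R).

(** By Tonelli and induction, densities multiply. This serves twice: for the leaves given the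
    centres, with affine [tau i], and for the [n] observations, with [tau i] the identity. *)
Lemma ge0_integral_iid_prob_change n (tau : 'I_n -> T' -> T) (g : 'I_n -> T -> R)
    (F : n.-tuple T -> \bar R) :
  (forall i, measurable_fun [set: T'] (tau i)) ->
  (forall i x, 0 <= g i x)%R -> (forall i, measurable_fun [set: T] (g i)) ->
  (forall i f, (forall x, 0 <= f x) -> measurable_fun [set: T] f ->
    \int[mu']_z f (tau i z) = \int[mu]_x (f x * (g i x)%:E)) ->
  (forall t, 0 <= F t) -> measurable_fun [set: n.-tuple T] F ->
  \int[iid_prob mu' n]_z F [tuple tau i (tnth z i) | i < n] =
  \int[iid_prob mu n]_t (F t * (\prod_(i < n) g i (tnth t i))%:E).
Proof.
elim: n tau g F => [|n IH] tau g F mtau g0 mg E F0 mF.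
  rewrite !integral_iid_prob0 big_ord0 mule1; congr (F _); exact: tuple0.
have mFcons x : measurable_fun [set: n.-tuple T] (fun t => F [tuple of x :: t]).
  exact: measurableT_comp mF (measurable_cons_tuple x).
rewrite ge0_integral_iid_probS//; last first.
  have := measurableT_comp mF; apply.
  apply/measurable_fun_tnthP => i.
  rewrite (_ : _ \o _ = tau i \o (@tnth _ _ ^~ i)).
    exact: measurableT_comp (mtau i) (measurable_tnth i).
  by apply/funext => z/=; rewrite tnth_mktuple.
rewrite ge0_integral_iid_probS//; last 2 first.
- by move=> t; rewrite mule_ge0// lee_fin prodr_ge0.
- by apply: emeasurable_funM => //; apply/measurable_EFinP; exact: measurable_prod_tnth.
pose G x := \int[iid_prob mu n]_t
  (F [tuple of x :: t] * (\prod_(i < n) g (lift ord0 i) (tnth t i))%:E).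
transitivity (\int[mu']_z G (tau ord0 z)).
  apply: eq_integral => z _.
  rewrite /G -(IH (fun i => tau (lift ord0 i)) (fun i => g (lift ord0 i))
    (fun t => F [tuple of tau ord0 z :: t]))//; last by move=> i; exact: E.
  apply: eq_integral => t _; congr (F _); apply: eq_from_tnth => i.
  rewrite tnth_mktuple; case: (unliftP ord0 i) => [j ->|->]; last by rewrite !tnth0.
  by rewrite !tnthS tnth_mktuple.
have G0 x : 0 <= G x.
  by apply: integral_ge0 => t _; rewrite mule_ge0// lee_fin prodr_ge0.
have mG : measurable_fun [set: T] G.
  (* The integrand is put as a function of the whole tuple [x :: t], the form for which partial
     integrals are known to be measurable. *)
  rewrite (_ : G = fun x => \int[iid_prob mu n]_t (fun s => F s *
      (\prod_(i < n) g (lift ord0 i) (tnth s (lift ord0 i)))%:E) [tuple of x :: t]).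
    apply: (@measurable_integral_iid_prob _ T R mu n (fun s => F s *
      (\prod_(i < n) g (lift ord0 i) (tnth s (lift ord0 i)))%:E)) => [x|].
      by rewrite mule_ge0// lee_fin prodr_ge0.
    apply: emeasurable_funM => //; apply/measurable_EFinP.
    apply: measurable_prod => i _.
    exact: (measurableT_comp (mg (lift ord0 i)) (measurable_tnth (lift ord0 i))).
  apply/funext => x; apply: eq_integral => t _; congr (_ * _%:E).
  by apply: eq_bigr => i _; rewrite tnthS.
rewrite E//; apply: eq_integral => x _.
rewrite -ge0_integralZr//; last 3 first.
- by apply: emeasurable_funM => //; apply/measurable_EFinP;
  exact: (@measurable_prod_tnth _ _ _ _ (fun i => g (lift ord0 i))).
- by move=> t _; rewrite mule_ge0// lee_fin prodr_ge0.
- by rewrite lee_fin.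
apply: eq_integral => t _.
rewrite -muleA -EFinM big_ord_recl tnth0 mulrC; congr (_ * (_ * _)%:E).
by apply: eq_bigr => i _; rewrite tnthS.
Qed.

End iid_prob_change.

Section iid_prob_cat.
Local Open Scope ereal_scope.
Context d (T : measurableType d) (R : realType) (mu : probability T R).

Lemma measurable_cat_pair k m : measurable_fun [set: k.-tuple T * m.-tuple T]
  (fun z => [tuple of z.1 ++ z.2] : (k + m).-tuple T).
Proof.
apply/measurable_fun_tnthP => i; case: (split_ordP i) => j ->.
  rewrite (_ : _ \o _ = (@tnth _ T ^~ j) \o fst).
    exact: measurableT_comp (measurable_tnth j) measurable_fst.
  by apply/funext => t /=; rewrite tnth_lshift.
rewrite (_ : _ \o _ = (@tnth _ T ^~ j) \o snd).
  exact: measurableT_comp (measurable_tnth j) measurable_snd.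
by apply/funext => t /=; rewrite tnth_rshift.
Qed.

Lemma measurable_cat_tuple k m (u : k.-tuple T) :
  measurable_fun [set: m.-tuple T] (fun t => [tuple of u ++ t] : (k + m).-tuple T).
Proof. exact: (measurableT_comp (@measurable_cat_pair k m) (measurable_pair1 u)). Qed.

Lemma measurable_integral_iid_prob_cat k m (F : (k + m).-tuple T -> \bar R) :
  (forall t, 0 <= F t) -> measurable_fun [set: (k + m).-tuple T] F ->
  measurable_fun [set: k.-tuple T] (fun u => \int[iid_prob mu m]_t F [tuple of u ++ t]).
Proof.
move=> F0 mF.
apply: (measurable_fun_fubini_tonelli_F
  (F \o (fun z : k.-tuple T * m.-tuple T => [tuple of z.1 ++ z.2]))).
  exact: measurableT_comp mF (@measurable_cat_pair k m).
by move=> x; exact: F0.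
Qed.

(** Here [u] will hold the centres and [t] the leaves, so that leaves are integrated first, at fixed
    centres. *)
Lemma ge0_integral_iid_prob_cat k m (F : (k + m).-tuple T -> \bar R) :
  (forall t, 0 <= F t) -> measurable_fun [set: (k + m).-tuple T] F ->
  \int[iid_prob mu (k + m)]_z F z =
  \int[iid_prob mu k]_u \int[iid_prob mu m]_t F [tuple of u ++ t].
Proof.
elim: k F => [|k IH] F F0 mF.
  rewrite integral_iid_prob0; apply: eq_integral => t _; congr (F _); exact: val_inj.
rewrite (ge0_integral_iid_probS mu (n := k + m) F0 mF).
rewrite ge0_integral_iid_probS//; last 2 first.
- by move=> u; exact: integral_ge0.
- exact: measurable_integral_iid_prob_cat.
apply: eq_integral => x _.
rewrite (IH (fun s => F [tuple of x :: s])); first 1 last.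
- by move=> s; exact: F0.
- exact: (measurableT_comp mF (@measurable_cons_tuple _ _ (k + m) x)).
apply: eq_integral => u _; apply: eq_integral => t _; congr (F _); exact: val_inj.
Qed.

End iid_prob_cat.

(** * Chi-square of correlated pairs *)

Section pair_density.
Context (R : realType).
Local Notation N01 := (std_normal R).
Implicit Types rho x y : R.

(* Density of (X, rho X + (1 - rho^2)^(1/2) Z) with respect to (X, Z). *)
Definition pair_lr rho x y : R := normal_lr (rho * x) (Num.sqrt (1 - rho ^+ 2)) y.

(* [(Num.sqrt (pair_chi rho0 rho1))^-1 - 1] is the chi-square distance of the
   centred bivariate normals of unit variances and correlations [rho1], [rho0]. *)
Definition pair_chi rho0 rho1 : R :=
  (1 - ((rho1 - rho0) / (1 + rho0)) ^+ 2) * (1 - ((rho1 - rho0) / (1 - rho0)) ^+ 2).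

Lemma onem_sqrE rho : 1 - rho ^+ 2 = (1 - rho) * (1 + rho).
Proof. ring. Qed.

Lemma onem_sqr_gt0 rho : 0 <= rho < 1 -> 0 < 1 - rho ^+ 2.
Proof. by move=> /andP[r0 r1]; rewrite subr_gt0 expr_lt1. Qed.

Lemma pair_lr_ge0 rho x y : 0 <= pair_lr rho x y.
Proof. exact: normal_lr_ge0. Qed.

Lemma pair_lr_gt0 rho x y : 0 <= rho < 1 -> 0 < pair_lr rho x y.
Proof.
move=> rho01; rewrite /pair_lr normal_lrE ?sqrtr_gt0 ?onem_sqr_gt0//.
by rewrite mulr_gt0 ?invr_gt0 ?sqrtr_gt0 ?onem_sqr_gt0 ?expR_gt0.
Qed.

Lemma pair_lr0 x y : pair_lr 0 x y = 1.
Proof.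
rewrite /pair_lr expr0n subr0 sqrtr1 mul0r /normal_lr divff//.
by rewrite gt_eqF// normal_pdf_gt0// oner_eq0.
Qed.

Lemma pair_lrE rho x y : 0 <= rho < 1 ->
  pair_lr rho x y = (Num.sqrt (1 - rho ^+ 2))^-1 *
    expR (y ^+ 2 / 2 - (y - rho * x) ^+ 2 / (2 * (1 - rho ^+ 2))).
Proof.
move=> rho01; rewrite /pair_lr normal_lrE ?sqrtr_gt0 ?onem_sqr_gt0//.
by rewrite sqr_sqrtr// ltW// onem_sqr_gt0.
Qed.

Lemma measurable_pair_lr rho d (T : measurableType d) (f g : T -> R) :
  0 <= rho < 1 -> measurable_fun [set: T] f -> measurable_fun [set: T] g ->
  measurable_fun [set: T] (fun t => pair_lr rho (f t) (g t)).
Proof.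
move=> rho01 mf mg; under eq_fun do rewrite pair_lrE//.
apply: measurable_funM => //; apply: measurableT_comp => //.
apply: measurable_funB; first by apply: measurable_funM => //; exact: measurable_funX.
apply: measurable_funM => //; apply: measurable_funX; apply: measurable_funB => //.
exact: measurable_funM.
Qed.

Lemma integral_pair_lr rho x : 0 <= rho < 1 ->
  (\int[N01]_y (pair_lr rho x y)%:E = 1)%E.
Proof. by move=> ?; rewrite integral_normal_lr// sqrtr_gt0 onem_sqr_gt0. Qed.

(** The integrand is the exponential of a quadratic form, integrated first in [y], then in [x]. The
    inner integral [v] is kept apart because a centre is shared by several leaves and is integrated
    after all of them. *)
Lemma integral_pair_lr_chi rho0 rho1 : 0 <= rho0 < 1 -> 0 <= rho1 < 1 ->
  `|rho1 - rho0| < 1 - rho0 ->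
  exists v : R -> R, [/\ forall x, 0 <= v x, measurable_fun [set: R] v,
    forall x, (\int[N01]_y (pair_lr rho1 x y ^+ 2 / pair_lr rho0 x y)%:E = (v x)%:E)%E &
    (\int[N01]_x (v x)%:E = ((Num.sqrt (pair_chi rho0 rho1))^-1)%:E)%E].
Proof.
move=> h0 h1 dlt; have [r00 r01] := andP h0; have [r10 r11] := andP h1.
have v0 := onem_sqr_gt0 h0; have v1 := onem_sqr_gt0 h1.
move: dlt; rewrite ltr_norml => /andP[dlt1 dlt2].
set v0' := 1 - rho0 ^+ 2 in v0; set v1' := 1 - rho1 ^+ 2 in v1.
(* Including the standard normal weights, the exponent is minus half of alpha x^2 - 2 beta x y +
   alpha y^2, since [1 + kappa = alpha]. The eigenvalues of this form are [alpha + beta] and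
   [alpha - beta]; the bound on the distance from [rho1] to [rho0] makes the first one positive. *)
pose alpha := 2 / v1' - v0'^-1.
pose beta := 2 * rho1 / v1' - rho0 / v0'.
pose kappa := 2 * rho1 ^+ 2 / v1' - rho0 ^+ 2 / v0'.
have nz : [/\ 1 - rho1 ^+ 2 != 0, 1 - rho0 ^+ 2 != 0, 1 + rho1 != 0, 1 - rho1 != 0 &
    1 + rho0 != 0 /\ 1 - rho0 != 0].
  by split; [rewrite gt_eqF|rewrite gt_eqF|lra|lra|split; lra].
have [nz1 nz2 nz3 nz4 [nz5 nz6]] := nz.
have aDb : alpha + beta = (1 - rho0 + (rho1 - rho0)) / ((1 - rho1) * (1 - rho0)).
  rewrite /alpha /beta /v1' /v0' !onem_sqrE; field.
  by rewrite nz3 nz4 nz5 nz6.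
have aBb : alpha - beta = (1 + rho0 - (rho1 - rho0)) / ((1 + rho1) * (1 + rho0)).
  rewrite /alpha /beta /v1' /v0' !onem_sqrE; field.
  by rewrite nz3 nz4 nz5 nz6.
have aDb0 : 0 < alpha + beta by rewrite aDb divr_gt0 ?mulr_gt0//; lra.
have aBb0 : 0 < alpha - beta by rewrite aBb divr_gt0 ?mulr_gt0//; lra.
have alpha0 : 0 < alpha by lra.
have kappaE : 1 + kappa = alpha.
  by rewrite /kappa /alpha /v1' /v0'; field; rewrite nz1 nz2.
(* Schur complement: the coefficient of [x ^+ 2] left once [y] is integrated out. *)
pose c' := kappa - beta ^+ 2 / alpha.
have c'E : 1 + c' = (alpha + beta) * (alpha - beta) / alpha.
  rewrite /c' addrA kappaE; field; exact: lt0r_neq0.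
have c'0 : 0 < 1 + c' by rewrite c'E divr_gt0// mulr_gt0.
have vconst : 0 <= Num.sqrt v0' / v1' / Num.sqrt alpha.
  by rewrite divr_ge0 ?sqrtr_ge0// divr_ge0 ?sqrtr_ge0// ltW.
have mexp : measurable_fun [set: R] (fun x => expR (0 * x - c' * x ^+ 2 / 2)).
  apply: measurableT_comp => //.
  apply: measurable_funB; first exact: measurable_funM.
  by apply: measurable_funM => //; apply: measurable_funM => //; exact: measurable_funX.
exists (fun x => Num.sqrt v0' / v1' / Num.sqrt alpha * expR (0 * x - c' * x ^+ 2 / 2)).
split=> [x||x|].
- by rewrite mulr_ge0 ?expR_ge0.
- exact: measurable_funM.
- rewrite EFinM.
  transitivity (\int[N01]_y ((Num.sqrt v0' / v1' * expR (- (kappa * x ^+ 2 / 2)))%:E *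
      (expR (beta * x * y - (alpha - 1) * y ^+ 2 / 2))%:E))%E.
    apply: eq_integral => y _; rewrite -EFinM; congr (_%:E).
    rewrite !pair_lrE// -/v0' -/v1' exprMn exprVn sqr_sqrtr ?ltW//.
    rewrite [((_ * expR _)^-1)]invfM invrK -expRN [LHS]mulrACA [v1'^-1 * _]mulrC.
    rewrite -[RHS]mulrA; congr (_ * _); rewrite expr2 -!expRD; congr expR.
    by rewrite /kappa /beta /alpha /v1' /v0'; field; rewrite nz1 nz2.
  rewrite ge0_integralZl//; last 2 first.
  - apply/measurable_EFinP; apply: measurableT_comp => //.
    apply: measurable_funB; first exact: measurable_funM.
    by apply: measurable_funM => //; apply: measurable_funM => //; exact: measurable_funX.
  - by rewrite lee_fin mulr_ge0 ?expR_ge0// divr_ge0 ?sqrtr_ge0// ltW.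
  have a1 : 1 + (alpha - 1) = alpha by rewrite addrC subrK.
  rewrite integral_normal_expR_quad a1// -!EFinM; congr (_%:E).
  rewrite -!mulrA; do 2 congr (_ * _).
  rewrite mulrCA; congr (_ * _); rewrite -expRD; congr expR.
  rewrite /c'; field; exact: lt0r_neq0.
under eq_integral do rewrite EFinM.
rewrite ge0_integralZl//; last exact/measurable_EFinP.
rewrite integral_normal_expR_quad// expr0n mul0r expR0 mulr1 -EFinM; congr (_%:E).
(* As [alpha * (1 + c')] is the determinant of the form, the claim follows from this identity by
   taking square roots. *)
have chiE : pair_chi rho0 rho1 * v0' = v1' ^+ 2 * (alpha * (1 + c')).
  rewrite c'E [alpha * _]mulrC divfK ?lt0r_neq0// aDb aBb.
  rewrite /pair_chi /v1' /v0' !onem_sqrE; field.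
  by rewrite nz3 nz4 nz5 nz6.
have chi0 : 0 <= pair_chi rho0 rho1.
  rewrite -(pmulr_lge0 _ v0) chiE mulr_ge0 ?sqr_ge0// mulr_ge0// ltW//.
have := congr1 Num.sqrt chiE.
rewrite (sqrtrM v0' chi0) (sqrtrM _ (sqr_ge0 v1')) (sqrtrM _ (ltW alpha0)) sqrtr_sqr.
rewrite gtr0_norm// => E.
have sv0 : Num.sqrt v0' != 0 by rewrite gt_eqF// sqrtr_gt0.
have -> : Num.sqrt (pair_chi rho0 rho1) =
    v1' * (Num.sqrt alpha * Num.sqrt (1 + c')) / Num.sqrt v0' by rewrite -E mulfK.
have nza : Num.sqrt alpha != 0 by rewrite gt_eqF// sqrtr_gt0.
have nzc : Num.sqrt (1 + c') != 0 by rewrite gt_eqF// sqrtr_gt0.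
by field; rewrite sv0 nza nzc lt0r_neq0.
Qed.

End pair_density.

(** * Le Cam's method with a mixture *)

Section le_cam.
Context d (T : measurableType d) (R : realType) (nu : {measure set T -> \bar R}).

(** The right side minus the left is exactly the sum of the two squares [sq1] and [sq2]. *)
Lemma le_cam_pointwise (K S f0 h Q0 Q1 : R) : 0 < K -> 0 < f0 -> 0 <= S ->
  3 / 4 * (Q1 - Q0) ^+ 2 * S <=
  (h - Q1) ^+ 2 * S + ((Q1 - Q0) ^+ 2 / (4 * K) * (S * S / f0) + K * ((h - Q0) ^+ 2 * f0)).
Proof.
move=> K0 f00 S0.
have sq1 : 0 <= (Q1 - h - (Q1 - Q0) / 2) ^+ 2 * S by rewrite mulr_ge0// sqr_ge0.
have sq2 : 0 <= (S * (Q1 - Q0) / (2 * (K * f0)) - (h - Q0)) ^+ 2 * (K * f0).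
  by rewrite mulr_ge0 ?sqr_ge0// mulr_ge0// ltW.
rewrite -subr_ge0; apply: le_trans (addr_ge0 sq1 sq2) _.
rewrite le_eqVlt; apply/orP; left; apply/eqP; field.
by rewrite !gt_eqF.
Qed.

Local Open Scope ereal_scope.

(* Testing against the mixture [f = N^-1 \sum_i f_i]: write
   [f (Q1 - Q0) = f (Q1 - Qh) + f (Qh - Q0)], apply AM-GM to both terms and
   integrate; the cross term is controlled by the second moment of [f / f0]. *)
Lemma le_cam (I : finType) (f : I -> T -> R) (f0 Qh : T -> R) (Q0 Q1 K : R)
    (M : \bar R) :
  (0 < #|I|)%N -> (0 < K)%R ->
  (forall i x, 0 <= f i x)%R -> (forall x, 0 < f0 x)%R ->
  (forall i, measurable_fun [set: T] (f i)) -> measurable_fun [set: T] f0 ->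
  measurable_fun [set: T] Qh ->
  (forall i, \int[nu]_x (f i x)%:E = 1) ->
  \sum_(i : I) \sum_(j : I) \int[nu]_x (f i x * f j x / f0 x)%:E <=
    (#|I|%:R ^+ 2 * K)%:E ->
  \int[nu]_x ((Qh x - Q0) ^+ 2 * f0 x)%:E <= M ->
  (forall i, \int[nu]_x ((Qh x - Q1) ^+ 2 * f i x)%:E <= M) ->
  ((Q1 - Q0) ^+ 2)%:E <= (2 * (1 + K))%:E * M.
Proof.
move=> I0 K0 fge0 f0gt0 mf mf0 mQ f1 chi le0 le1.
have M0 : 0 <= M.
  by apply: le_trans le0; apply: integral_ge0 => x _; rewrite lee_fin mulr_ge0 ?sqr_ge0// ltW.
have K10 : (0 < 2 * (1 + K))%R by lra.
case: M M0 le0 le1 => [m| |//] M0 le0 le1; last by rewrite gt0_muley ?leey ?lte_fin.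
set N : R := #|I|%:R.
have N0 : (0 < N)%R by rewrite ltr0n.
set D := (Q1 - Q0)%R.
have D0 : (0 <= D ^+ 2)%R by exact: sqr_ge0.
pose A x := \sum_(i : I) ((Qh x - Q1) ^+ 2 * f i x)%:E.
pose B x := \sum_(i : I) \sum_(j : I) (f i x * f j x / f0 x)%:E.
pose C x := ((Qh x - Q0) ^+ 2 * f0 x)%:E.
have ge0B i j x : 0 <= (f i x * f j x / f0 x)%:E.
  by rewrite lee_fin divr_ge0 ?mulr_ge0// ltW.
have A0 x : 0 <= A x by apply: sume_ge0 => i _; rewrite lee_fin mulr_ge0 ?sqr_ge0.
have B0 x : 0 <= B x by do 2 apply: sume_ge0 => ? _.
have C0 x : 0 <= C x by rewrite lee_fin mulr_ge0 ?sqr_ge0// ltW.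
have msq c : measurable_fun [set: T] (fun x => (Qh x - c) ^+ 2)%R.
  by apply: measurable_funX; exact: measurable_funB.
have mA i : measurable_fun [set: T] (fun x => ((Qh x - Q1) ^+ 2 * f i x)%:E).
  by apply/measurable_EFinP; exact: measurable_funM.
have mB i j : measurable_fun [set: T] (fun x => (f i x * f j x / f0 x)%:E).
  apply/measurable_EFinP; apply: measurable_funM; first exact: measurable_funM.
  by apply: ge0_measurable_funV => // x; exact: ltW.
have mC : measurable_fun [set: T] C.
  by apply/measurable_EFinP; exact: measurable_funM.
have mAs : measurable_fun [set: T] A by exact: emeasurable_sum.
have mBs : measurable_fun [set: T] B.
  by apply: emeasurable_sum => i; exact: emeasurable_sum.
(* [le_cam_pointwise] is used with [K * N] because [S], the sum of the [f i], has mass [N]. The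
   three terms integrate to at most N m, N D^2 / 4 and K N m, and 3/4 - 1/4 = 1/2 yields the factor
   [2 * (1 + K)]. *)
have cB0 : (0 <= D ^+ 2 / (4 * (K * N)))%R.
  by rewrite divr_ge0// mulr_ge0// mulr_ge0// ltW.
have cC0 : (0 <= K * N)%R by rewrite mulr_ge0// ltW.
have intL : \int[nu]_x ((3 / 4 * D ^+ 2)%:E * \sum_(i : I) (f i x)%:E) =
    (3 / 4 * D ^+ 2 * N)%:E.
  rewrite ge0_integralZl//; last 3 first.
  - by apply: emeasurable_sum => i; exact/measurable_EFinP.
  - by move=> x _; apply: sume_ge0 => i _; rewrite lee_fin.
  - by rewrite lee_fin mulr_ge0// divr_ge0.
  rewrite ge0_integral_sum//; last 2 first.
  - by move=> i; exact/measurable_EFinP.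
  - by move=> i x _; rewrite lee_fin.
  by under eq_bigr do rewrite f1; rewrite sumEFin sumr_const EFinM.
have intA : \int[nu]_x A x <= (N * m)%:E.
  rewrite ge0_integral_sum//; last by move=> i x _; rewrite lee_fin mulr_ge0 ?sqr_ge0.
  apply: le_trans (lee_sum _ (fun i _ => le1 i)) _.
  by rewrite sumEFin sumr_const mulr_natl.
have intB : \int[nu]_x B x <= (N ^+ 2 * K)%:E.
  rewrite ge0_integral_sum//; last 2 first.
  - by move=> i; exact: emeasurable_sum.
  - by move=> i x _; apply: sume_ge0.
  apply: le_trans chi; apply: lee_sum => i _.
  by rewrite ge0_integral_sum.
have : (3 / 4 * D ^+ 2 * N)%:E <=
    \int[nu]_x (A x + ((D ^+ 2 / (4 * (K * N)))%:E * B x + (K * N)%:E * C x)).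
  rewrite -intL; apply: ge0_le_integral => //.
  - move=> x _; apply: mule_ge0; first by rewrite lee_fin mulr_ge0// divr_ge0.
    by apply: sume_ge0 => i _; rewrite lee_fin.
  - by apply: measurable_funeM; apply: emeasurable_sum => i; exact/measurable_EFinP.
  - apply: emeasurable_funD => //; apply: emeasurable_funD; exact: measurable_funeM.
  - move=> x _.
    have -> : A x = ((Qh x - Q1) ^+ 2 * \sum_i f i x)%:E.
      by rewrite /A sumEFin mulr_sumr.
    have -> : B x = ((\sum_i f i x) * (\sum_i f i x) / f0 x)%:E.
      rewrite /B -mulrA mulr_suml -sumEFin; apply: eq_bigr => i _.
      rewrite sumEFin mulrA mulr_sumr mulr_suml //.
    rewrite sumEFin /C -!EFinM -!EFinD lee_fin; apply: le_cam_pointwise => //.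
    + exact: mulr_gt0.
    + exact: sumr_ge0.
rewrite ge0_integralD//; last 2 first.
- by move=> x _; rewrite adde_ge0// mule_ge0// lee_fin.
- apply: emeasurable_funD; exact: measurable_funeM.
rewrite ge0_integralD//; last 4 first.
- by move=> x _; rewrite mule_ge0// lee_fin.
- exact: measurable_funeM.
- by move=> x _; rewrite mule_ge0// lee_fin.
- exact: measurable_funeM.
rewrite ge0_integralZl// ge0_integralZl//.
have h1 := lee_wpmul2l (cB0 : 0 <= (D ^+ 2 / (4 * (K * N)))%:E) intB.
have h2 := lee_wpmul2l (cC0 : 0 <= (K * N)%:E) le0.
move=> /le_trans/(_ (leeD intA (leeD h1 h2))).
rewrite -!EFinM -!EFinD !lee_fin => H.
have : (3 / 4 * D ^+ 2 * N <= (m + D ^+ 2 / 4 + K * m) * N)%R.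
  apply: le_trans H _; rewrite le_eqVlt; apply/orP; left; apply/eqP; field.
  by rewrite !gt_eqF.
rewrite ler_pM2r// => {}H; lra.
Qed.

End le_cam.

(** * Star covariances *)

Section star_model.
Context (R : realType) (k m : nat) (l : 'I_m -> 'I_k).
Local Notation N01 := (std_normal R).
Implicit Types c : 'I_m -> R.

Definition star_loading c : 'M[R]_(m, k) :=
  \matrix_(i, j) (if j == l i then c i else 0).

(* The centres are the coordinates [lshift m j], the leaves [rshift k i]; the
   factor maps z to the vector whose leaf i is c_i z_(l i) + (1 - c_i^2)^(1/2) z_i. *)
Definition star_factor c : 'M[R]_(k + m) :=
  block_mx 1%:M 0 (star_loading c) (diag_mx (\row_i Num.sqrt (1 - c i ^+ 2))).

Definition star_cov c : 'M[R]_(k + m) :=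
  block_mx 1%:M (star_loading c)^T (star_loading c) 1%:M.

(** Distinct leaves of one centre have covariance [c i * c j], which the second hypothesis kills.
    Positive semi-definiteness of [star_cov] then comes from [psd_mul_tr]. *)
Lemma star_factor_mul_tr c : (forall i, 0 <= c i < 1) ->
  (forall i j, i != j -> l i = l j -> c i * c j = 0) ->
  star_factor c *m (star_factor c)^T = star_cov c.
Proof.
move=> c01 cdisj; rewrite /star_factor tr_block_mx mulmx_block !trmx0 !trmx1.
rewrite !mul1mx !mulmx1 !mulmx0 !mul0mx !addr0 tr_diag_mx; congr block_mx.
apply/matrixP => i j; rewrite !mxE.
rewrite (bigD1 (l i))//= big1 ?addr0; last first.
  by move=> a /negbTE ai; rewrite !mxE ai mul0r.
rewrite (bigD1 i)//= [X in _ + (_ + X)]big1 ?addr0; last first.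
  by move=> a ai; rewrite !mxE eq_sym (negbTE ai) mulr0n mul0r.
rewrite !mxE !eqxx mulr1n.
have [->|ij] := eqVneq i j.
  rewrite eqxx mulr1n -[_ * c j]expr2 -[Num.sqrt _ * _]expr2 sqr_sqrtr.
    by rewrite addrC subrK.
  by rewrite ltW// onem_sqr_gt0.
rewrite mulr0n mulr0 addr0 mulr0n; case: eqP => [lij|_]; last by rewrite mulr0.
exact: cdisj.
Qed.

Lemma mulmx_tuple_star_factor c (u : k.-tuple R) (t : m.-tuple R) :
  mulmx_tuple (star_factor c) [tuple of u ++ t] =
  [tuple of u ++ [tuple c i * tnth u (l i) + Num.sqrt (1 - c i ^+ 2) * tnth t i | i < m]].
Proof.
apply: eq_from_tnth => a; rewrite tnth_mktuple.
have -> : \col_j tnth [tuple of u ++ t] j =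
    col_mx (\col_j tnth u j) (\col_j tnth t j) :> 'cV[R]_(k + m).
  apply/colP => j; rewrite mxE; case: (split_ordP j) => j' ->.
    by rewrite tnth_lshift col_mxEu mxE.
  by rewrite tnth_rshift col_mxEd mxE.
rewrite mul_block_col mul1mx mul0mx addr0.
case: (split_ordP a) => i ->; first by rewrite tnth_lshift col_mxEu mxE.
rewrite tnth_rshift col_mxEd tnth_mktuple mxE; congr (_ + _).
  rewrite mxE (bigD1 (l i))//= big1 ?addr0 ?mxE ?eqxx//.
  by move=> j /negbTE ji; rewrite !mxE ji mul0r.
rewrite mxE (bigD1 i)//= big1 ?addr0 ?mxE ?eqxx ?mulr1n//.
by move=> j ji; rewrite !mxE eq_sym (negbTE ji) mulr0n mul0r.
Qed.

(** Each [c i] occurs once in each off-diagonal block. A general [h] covers both the sparsity sum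
    and [offdiag_sq]. *)
Lemma sum_star_cov (h : R -> R) c : h 0 = 0 ->
  \sum_(i < k + m) \sum_(j < k + m | j != i) h (star_cov c i j) =
  2 * \sum_(i < m) h (c i).
Proof.
move=> h0; rewrite big_split_ord /= mulr_natl mulr2n; congr (_ + _).
  transitivity (\sum_(i < k) \sum_(j < m) (if i == l j then h (c j) else 0)).
    apply: eq_bigr => i _; rewrite big_split_ord/= big1 ?add0r; last first.
      by move=> j ji; rewrite block_mxEul mxE -(inj_eq (@lshift_inj k m)) eq_sym (negbTE ji).
    apply: eq_big => [j|j _]; first by rewrite eq_rlshift.
    by rewrite block_mxEur !mxE; case: ifP.
  rewrite exchange_big; apply: eq_bigr => j _.
  by rewrite -big_mkcond big_pred1_eq.
apply: eq_bigr => i _; rewrite big_split_ord/= [X in _ + X]big1 ?addr0; last first.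
  by move=> j ji; rewrite block_mxEdr mxE -(inj_eq (@rshift_inj k m)) eq_sym (negbTE ji).
rewrite (bigD1 (l i)) ?eq_lrshift//= block_mxEdl mxE eqxx big1 ?addr0// => j /andP[_ /negbTE ji].
by rewrite block_mxEdl mxE ji.
Qed.

Lemma star_cov_diag c i : star_cov c i i = 1.
Proof.
by case: (split_ordP i) => j ->; rewrite ?block_mxEul ?block_mxEdr mxE eqxx.
Qed.

End star_model.

Lemma psd_mul_tr (R : realType) p (A : 'M[R]_p) : psd (A *m A^T).
Proof.
split=> [|u]; first by rewrite trmx_mul trmxK.
rewrite mulmxA -mulmxA -[u in A^T *m u]trmxK -trmx_mul mxE sumr_ge0// => i _.
by rewrite [X in _ * X]mxE -expr2 sqr_ge0.
Qed.

Section gaussian_prob.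
Context (R : realType).
Local Notation N01 := (std_normal R).

Lemma measurable_mulmx_tuple p (A : 'M[R]_p) :
  measurable_fun [set: p.-tuple R] (mulmx_tuple A).
Proof.
apply/measurable_fun_tnthP => i.
rewrite (_ : _ \o _ = fun z : p.-tuple R => \sum_j A i j * tnth z j).
  by apply: measurable_sum => j; apply: measurable_funM => //; exact: measurable_tnth.
apply/funext => z /=; rewrite tnth_mktuple mxE.
by apply: eq_bigr => j _; rewrite mxE.
Qed.

HB.instance Definition _ p (A : 'M[R]_p) := @isMeasurableFun.Build _ _ _ _
  (mulmx_tuple A) (measurable_mulmx_tuple A).

Definition gaussian_prob p (A : 'M[R]_p) : probability (p.-tuple R) R :=
  distribution (iid_prob N01 p) (mulmx_tuple A).

Lemma gaussian_law_prob p (A : 'M[R]_p) : gaussian_law (A *m A^T) (gaussian_prob A).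
Proof.
exists A, (iid_prob N01 p); split => //; exact: iid_law_iid_prob.
Qed.

End gaussian_prob.

(** * Densities of star laws *)

Section star_density.
Context (R : realType) (k m : nat) (l : 'I_m -> 'I_k).
Local Notation N01 := (std_normal R).
Local Notation gam := (iid_prob N01).
Implicit Types c : 'I_m -> R.

(** Density relative to N(0, I): the centres are standard normal under both laws, so only the
    leaves, given their centres, contribute. *)
Definition star_lr c (z : (k + m).-tuple R) : R :=
  \prod_(i < m) pair_lr (c i) (tnth z (lshift m (l i))) (tnth z (rshift k i)).

Lemma star_lr_ge0 c z : 0 <= star_lr c z.
Proof. by apply: prodr_ge0 => i _; exact: pair_lr_ge0. Qed.

Lemma star_lr_gt0 c z : (forall i, 0 <= c i < 1) -> 0 < star_lr c z.
Proof. by move=> c01; apply: prodr_gt0 => i _; exact: pair_lr_gt0. Qed.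

Lemma measurable_star_lr c : (forall i, 0 <= c i < 1) ->
  measurable_fun [set: (k + m).-tuple R] (star_lr c).
Proof.
move=> c01; apply: measurable_prod => i _.
by apply: measurable_pair_lr => //; exact: measurable_tnth.
Qed.

Local Open Scope ereal_scope.

(** At fixed centres [u], [star_factor] acts affinely on each leaf coordinate separately, so the
    change of measure is a product of one-dimensional ones. *)
Lemma ge0_integral_star_prob c (F : (k + m).-tuple R -> \bar R) :
  (forall i, 0 <= c i < 1)%R -> (forall z, 0 <= F z) ->
  measurable_fun [set: (k + m).-tuple R] F ->
  \int[gaussian_prob (star_factor l c)]_z F z =
  \int[gam (k + m)]_z (F z * (star_lr c z)%:E).
Proof.
move=> c01 F0 mF; rewrite ge0_integral_distribution//.
rewrite (@ge0_integral_iid_prob_cat _ _ _ N01 k m); first 1 last.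
- by move=> z; exact: F0.
- exact: measurableT_comp mF (measurable_mulmx_tuple _).
rewrite (@ge0_integral_iid_prob_cat _ _ _ N01 k m)//; last 2 first.
- by move=> z; rewrite mule_ge0// lee_fin star_lr_ge0.
- by apply: emeasurable_funM => //; apply/measurable_EFinP; exact: measurable_star_lr.
apply: eq_integral => u _.
pose s i := Num.sqrt (1 - c i ^+ 2).
have s0 i : (0 < s i)%R by rewrite sqrtr_gt0 onem_sqr_gt0.
have mFu : measurable_fun [set: m.-tuple R] (fun t => F [tuple of u ++ t]).
  exact: (measurableT_comp mF (@measurable_cat_tuple _ R k m u)).
have E := @ge0_integral_iid_prob_change _ _ R R R N01 N01 m
  (fun i x => c i * tnth u (l i) + s i * x)%R
  (fun i => pair_lr (c i) (tnth u (l i))) (fun t : m.-tuple R => F [tuple of u ++ t]).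
transitivity (\int[gam m]_(t in [set: m.-tuple R]) (F [tuple of u ++
    [tuple (c i * tnth u (l i) + s i * tnth t i)%R | i < m]])).
  by apply: eq_integral => t _; rewrite /= mulmx_tuple_star_factor.
rewrite E; first 1 last.
- by move=> i; apply: measurable_funD => //; exact: measurable_funM.
- by move=> i x; exact: pair_lr_ge0.
- by move=> i; exact: measurable_pair_lr.
- by move=> i f f0 mf; exact: ge0_integral_normal_affine.
- by [].
- by [].
- apply: eq_integral => t _; congr (_ * _%:E).
  by apply: eq_bigr => i _; rewrite tnth_lshift tnth_rshift.
Qed.

Lemma ge0_integral_star_sample n c (F : n.-tuple ((k + m).-tuple R) -> \bar R) :
  (forall i, 0 <= c i < 1)%R -> (forall z, 0 <= F z) ->
  measurable_fun [set: n.-tuple ((k + m).-tuple R)] F ->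
  \int[iid_prob (gaussian_prob (star_factor l c)) n]_x F x =
  \int[iid_prob (gam (k + m)) n]_x (F x * (\prod_(a < n) star_lr c (tnth x a))%:E).
Proof.
move=> c01 F0 mF.
rewrite -(@ge0_integral_iid_prob_change _ _ _ _ _ (gam (k + m))
  (gaussian_prob (star_factor l c)) n (fun=> id) (fun=> star_lr c)); first 1 last.
- by [].
- by move=> _ z; exact: star_lr_ge0.
- by move=> _; exact: measurable_star_lr.
- by move=> _ f f0 mf; exact: ge0_integral_star_prob.
- by [].
- by [].
- apply: eq_integral => x _; congr (F _).
  by apply: eq_from_tnth => i; rewrite tnth_mktuple.
Qed.

End star_density.

(** * Mixtures over the choice of leaves *)

Section star_minimax.
Context (R : realType) (k m : nat) (l : 'I_m -> 'I_k).
Local Notation N01 := (std_normal R).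
Local Notation gam := (iid_prob N01).
Implicit Types (e : 'I_k -> 'I_m) (rho : R).

Definition leaf_weight rho e (i : 'I_m) : R := if i == e (l i) then rho else 0.

(** Leaves are grouped by centre: in the group of [j] only [e j] can satisfy the condition, and it
    does when [e j = e' j]. The operation is abstract because sums are needed for the class and for
    Q, products for the chi-square. *)
Lemma big_leaf_weight (S : Type) (idx : S) (op : Monoid.com_law idx)
    (F : 'I_m -> 'I_k -> S) e e' : cancel e l -> cancel e' l ->
  \big[op/idx]_(i < m) (if (i == e (l i)) && (i == e' (l i)) then F i (l i) else idx) =
  \big[op/idx]_(j < k) (if e j == e' j then F (e j) j else idx).
Proof.
move=> el e'l; rewrite (partition_big l xpredT)//=; apply: eq_bigr => j _.
case: eqP => [ee'|ee'].
  rewrite (bigD1 (e j)) ?el//= eqxx ee' eqxx/= big1 ?Monoid.mulm1 -?ee'//.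
  by move=> i /andP[/eqP -> /negbTE]; rewrite -ee' => ->.
rewrite big1// => i /eqP ->; case: andP => // -[/eqP ie /eqP ie'].
by case: ee'; rewrite -ie.
Qed.

Lemma sum_leaf_weight (h : R -> R) rho e : h 0 = 0 -> cancel e l ->
  \sum_(i < m) h (leaf_weight rho e i) = k%:R * h rho.
Proof.
move=> h0 el.
have := @big_leaf_weight _ _ (GRing.add : Monoid.com_law 0) (fun _ _ => h rho) _ _ el el.
under eq_bigr => i _ do rewrite andbb.
under [in RHS]eq_bigr => i _ do rewrite eqxx.
rewrite sumr_const card_ord mulr_natl => <-; apply: eq_bigr => i _.
by rewrite /leaf_weight; case: ifP.
Qed.

Lemma leaf_weight01 rho e i : 0 <= rho < 1 -> 0 <= leaf_weight rho e i < 1.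
Proof. by move=> rho01; rewrite /leaf_weight; case: ifP => // _; rewrite lexx ltr01. Qed.

Lemma leaf_weight_disj rho e i i' : i != i' -> l i = l i' ->
  leaf_weight rho e i * leaf_weight rho e i' = 0.
Proof.
move=> ii' lii'; rewrite /leaf_weight lii'.
have [E|_] := eqVneq i; last by rewrite mul0r.
have [E'|_] := eqVneq i'; last by rewrite mulr0.
by case/eqP: ii'; rewrite E -E'.
Qed.

(** Given the centres, a leaf chosen by both [e] and [e'] contributes [v]; any other contributes 1,
    since densities integrate to 1. The condition on [e0] places the reference loading on the common
    leaves; it holds when [rho0 = 0] and when the three choices coincide. *)
Lemma integral_star_lr_chi rho0 rho1 e e' e0 : 0 <= rho0 < 1 -> 0 <= rho1 < 1 ->
  `|rho1 - rho0| < 1 - rho0 -> cancel e l -> cancel e' l ->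
  (forall i, leaf_weight rho0 e0 i =
     if (i == e (l i)) && (i == e' (l i)) then rho0 else 0) ->
  (\int[gam (k + m)]_z (star_lr l (leaf_weight rho1 e) z *
    star_lr l (leaf_weight rho1 e') z / star_lr l (leaf_weight rho0 e0) z)%:E =
  (\prod_(j < k) (if e j == e' j then (Num.sqrt (pair_chi rho0 rho1))^-1 else 1))%:E)%E.
Proof.
move=> h0 h1 dlt el e'l cE.
have [v [v0 mv vE vint]] := integral_pair_lr_chi h0 h1 dlt.
pose c := leaf_weight rho1 e; pose c' := leaf_weight rho1 e'; pose c0 := leaf_weight rho0 e0.
have c01 i : 0 <= c i < 1 by exact: leaf_weight01.
have c'01 i : 0 <= c' i < 1 by exact: leaf_weight01.
have c001 i : 0 <= c0 i < 1 by exact: leaf_weight01.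
pose h i x y := pair_lr (c i) x y * pair_lr (c' i) x y / pair_lr (c0 i) x y.
have hge0 i x y : 0 <= h i x y.
  by apply: divr_ge0; [apply: mulr_ge0|]; exact: pair_lr_ge0.
have mh i d (T : measurableType d) (f g : T -> R) : measurable_fun [set: T] f ->
    measurable_fun [set: T] g -> measurable_fun [set: T] (fun t => h i (f t) (g t)).
  move=> mf mg; apply: measurable_funM.
    by apply: measurable_funM; exact: measurable_pair_lr.
  apply: ge0_measurable_funV; last exact: measurable_pair_lr.
  by move=> t; exact: pair_lr_ge0.
have hint i x : (\int[N01]_y (h i x y)%:E =
    (if (i == e (l i)) && (i == e' (l i)) then v x else 1)%:E)%E.
  rewrite /h /c /c' /c0 cE /leaf_weight.
  case: eqP => _ /=; case: eqP => _ /=.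
  - by rewrite -vE; apply: eq_integral => y _; rewrite expr2.
  - rewrite -(integral_pair_lr x h1); apply: eq_integral => y _.
    by rewrite !pair_lr0 mulr1 divr1.
  - rewrite -(integral_pair_lr x h1); apply: eq_integral => y _.
    by rewrite !pair_lr0 mul1r divr1.
  - under eq_integral do rewrite !pair_lr0 mul1r divr1.
    by rewrite integral_cst//= probability_setT mule1.
rewrite ge0_integral_iid_prob_cat//; last 2 first.
- by move=> z; rewrite lee_fin; apply: divr_ge0; [apply: mulr_ge0|]; exact: star_lr_ge0.
- apply/measurable_EFinP; apply: measurable_funM.
    by apply: measurable_funM; exact: measurable_star_lr.
  apply: ge0_measurable_funV; last exact: measurable_star_lr.
  by move=> z; exact: star_lr_ge0.
pose w j x := if e j == e' j then v x else 1.
transitivity (\int[gam k]_u (\prod_(j < k) w j (tnth u j))%:E)%E.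
  apply: eq_integral => u _.
  transitivity (\int[gam m]_t (\prod_(i < m) h i (tnth u (l i)) (tnth t i))%:E)%E.
    apply: eq_integral => t _; congr (_%:E).
    rewrite /star_lr -big_split/= -prodf_div; apply: eq_bigr => i _.
    by rewrite tnth_lshift tnth_rshift.
  rewrite (@ge0_integral_iid_prob_prod _ _ _ N01 m (fun i => h i (tnth u (l i)))); first 1 last.
  - by move=> i x; exact: hge0.
  - by move=> i; exact: mh.
  under eq_bigr do rewrite hint.
  rewrite prodEFin; congr (_%:E).
  exact: (@big_leaf_weight _ _ (GRing.mul : Monoid.com_law 1) (fun i j => v (tnth u j))).
rewrite (@ge0_integral_iid_prob_prod _ _ _ N01 k w); first 1 last.
- by move=> j x; rewrite /w; case: ifP.
- by move=> j; rewrite /w; case: (e j == e' j).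
rewrite -prodEFin; apply: eq_bigr => j _; rewrite /w; case: (e j == e' j); first exact: vint.
by rewrite integral_cst//= probability_setT mule1.
Qed.

(** This is [le_cam] with densities relative to [n] standard Gaussian vectors; independence raises
    the second moment for one observation to the power [n]. *)
Lemma star_minimax_risk (n : nat) (J : finType) (e : J -> 'I_k -> 'I_m) e0
    (rho0 rho1 q r K : R) :
  0 <= rho0 < 1 -> 0 <= rho1 < 1 -> `|rho1 - rho0| < 1 - rho0 ->
  (forall a, cancel (e a) l) -> cancel e0 l ->
  (forall a b i, leaf_weight rho0 e0 i =
     if (i == e a (l i)) && (i == e b (l i)) then rho0 else 0) ->
  2 * (k%:R * abs_pow q rho0) <= r -> 2 * (k%:R * abs_pow q rho1) <= r ->
  (0 < #|J|)%N -> 0 < K ->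
  \sum_(a : J) \sum_(b : J) (\prod_(j < k)
    (if e a j == e b j then (Num.sqrt (pair_chi rho0 rho1))^-1 else 1)) ^+ n <=
    #|J|%:R ^+ 2 * K ->
  (((2 * k%:R * (rho1 ^+ 2 - rho0 ^+ 2)) ^+ 2 / (2 * (1 + K)))%:E <=
   minimax_risk n (k + m) q r)%E.
Proof.
move=> h0 h1 dlt el e0l cE q0 q1 J0 K0 chi.
(* For [q = 0] this is the convention built into [abs_pow]; zero entries thus cost nothing. *)
have abs_pow0 : abs_pow q 0 = 0.
  by rewrite /abs_pow eqxx; case: eqP => // /eqP q0'; rewrite normr0 powR0.
pose A rho e' := star_factor l (leaf_weight rho e').
pose nu := iid_prob (gam (k + m)) n.
pose F rho e' (x : n.-tuple ((k + m).-tuple R)) :=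
  \prod_(a < n) star_lr l (leaf_weight rho e') (tnth x a).
have lw01 rho e' i : 0 <= rho < 1 -> 0 <= leaf_weight rho e' i < 1.
  exact: leaf_weight01.
have F0 rho e' x : 0 <= rho < 1 -> 0 < F rho e' x.
  by move=> rho01; apply: prodr_gt0 => a _; apply: star_lr_gt0 => i; exact: lw01.
have mF rho e' : 0 <= rho < 1 -> measurable_fun [set: n.-tuple ((k + m).-tuple R)] (F rho e').
  move=> rho01; apply: (@measurable_prod_tnth _ _ _ n (fun=> star_lr l (leaf_weight rho e'))).
  by move=> _; apply: measurable_star_lr => i; exact: lw01.
have FE rho e' (G : n.-tuple ((k + m).-tuple R) -> \bar R) : 0 <= rho < 1 ->
    (forall x, 0 <= G x)%E -> measurable_fun [set: n.-tuple ((k + m).-tuple R)] G ->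
    (\int[iid_prob (gaussian_prob (A rho e')) n]_x G x = \int[nu]_x (G x * (F rho e' x)%:E))%E.
  by move=> rho01 G0 mG; apply: ge0_integral_star_sample => // i; exact: lw01.
have cov rho e' : 0 <= rho < 1 -> cancel e' l ->
    2 * (k%:R * abs_pow q rho) <= r ->
    [/\ sparse_corr q r (A rho e' *m (A rho e')^T),
      gaussian_sample (A rho e' *m (A rho e')^T) (iid_prob (gaussian_prob (A rho e')) n) &
      offdiag_sq (A rho e' *m (A rho e')^T) = 2 * k%:R * rho ^+ 2].
  move=> rho01 e'l le_r.
  have AE : A rho e' *m (A rho e')^T = star_cov l (leaf_weight rho e').
    apply: star_factor_mul_tr => [i|]; [exact: lw01|exact: leaf_weight_disj].
  split.
  - split; first exact: psd_mul_tr.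
    + by rewrite AE (sum_star_cov _ _ abs_pow0) (sum_leaf_weight _ abs_pow0 e'l).
    + by move=> i; rewrite AE star_cov_diag.
  - exists (gaussian_prob (A rho e')); split; first exact: gaussian_law_prob.
    exact: iid_law_iid_prob.
  - have sq0 : (fun x : R => x ^+ 2) 0 = 0 by rewrite expr0n.
    by rewrite /offdiag_sq AE (@sum_star_cov _ _ _ l (fun x => x ^+ 2) _ sq0)
      (@sum_leaf_weight (fun x => x ^+ 2) _ _ sq0 e'l) mulrA.
apply: le_ereal_inf_tmp => _ [Qh mQ <-].
have risk rho e' : 0 <= rho < 1 -> cancel e' l -> 2 * (k%:R * abs_pow q rho) <= r ->
    (\int[nu]_x ((Qh x - 2 * k%:R * rho ^+ 2) ^+ 2 * F rho e' x)%:E <= max_risk q r Qh)%E.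
  move=> rho01 e'l le_r; have [S1 S2 S3] := cov _ _ rho01 e'l le_r.
  apply: ereal_sup_ubound; exists (A rho e' *m (A rho e')^T).
  exists (iid_prob (gaussian_prob (A rho e')) n); split; [exact: S1|exact: S2|].
  rewrite S3; under eq_integral do rewrite EFinM.
  symmetry; apply: (FE rho e' (fun x => ((Qh x - 2 * k%:R * rho ^+ 2) ^+ 2)%:E) rho01).
  - by move=> x; rewrite lee_fin sqr_ge0.
  - by apply/measurable_EFinP; apply: measurable_funX; exact: measurable_funB.
rewrite EFinM muleC lee_pdivrMl; last by rewrite mulr_gt0// addr_gt0.
rewrite mulrBr.
apply: (@le_cam _ _ _ nu J (fun a => F rho1 (e a)) (F rho0 e0)) => //.
- by move=> a x; rewrite ltW// F0.
- by move=> x; exact: F0.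
- by move=> a; exact: mF.
- exact: mF.
- exact: mQ.
- move=> a; rewrite -[RHS](@probability_setT _ _ _ (iid_prob (gaussian_prob (A rho1 (e a))) n)).
  under eq_integral do rewrite -[X in X%:E]mul1r EFinM.
  rewrite -[RHS]mul1e -(integral_cst _ measurableT).
  by symmetry; apply: (FE rho1 (e a) (cst 1%E) h1).
- apply: le_trans (_ : _ <= (\sum_(a : J) \sum_(b : J) (\prod_(j < k)
    (if e a j == e b j then (Num.sqrt (pair_chi rho0 rho1))^-1 else 1)) ^+ n)%:E)%E _;
    last by rewrite lee_fin.
  rewrite -sumEFin; apply: lee_sum => a _; rewrite -sumEFin; apply: lee_sum => b _.
  pose H z := star_lr l (leaf_weight rho1 (e a)) z *
    star_lr l (leaf_weight rho1 (e b)) z / star_lr l (leaf_weight rho0 e0) z.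
  rewrite (_ : (fun x => _) = fun x => (\prod_(s < n) H (tnth x s))%:E); last first.
    by apply/funext => x; rewrite /F -big_split/= -prodf_div.
  rewrite (@ge0_integral_iid_prob_prod _ _ _ (gam (k + m)) n (fun=> H)); first 1 last.
  + by move=> _ z; apply: divr_ge0; [apply: mulr_ge0|]; exact: star_lr_ge0.
  + move=> _; apply: measurable_funM.
      by apply: measurable_funM; apply: measurable_star_lr => i; exact: lw01.
    apply: ge0_measurable_funV; last by apply: measurable_star_lr => i; exact: lw01.
    by move=> z; exact: star_lr_ge0.
  under eq_bigr do rewrite /H integral_star_lr_chi//.
  by rewrite prodEFin prodr_const card_ord.
- exact: risk.
- by move=> a; exact: risk.
Qed.

End star_minimax.

(** * Lower bounds for the two terms of the rate *)

Section lower_bounds.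
Context (R : realType).
Implicit Types q r rho x : R.

Lemma bernoulli_inequality x n : 0 <= x <= 1 -> 1 - n%:R * x <= (1 - x) ^+ n.
Proof.
move=> /andP[x0 x1]; elim: n => [|n IH]; first by rewrite mul0r subr0 expr0.
have x1' : 0 <= 1 - x by rewrite subr_ge0.
rewrite exprS; apply: le_trans (ler_wpM2l x1' IH).
rewrite -natr1 -subr_ge0 (_ : _ - _ = n%:R * x ^+ 2); last ring.
by rewrite mulr_ge0 ?sqr_ge0.
Qed.

Lemma abs_pow_powR q x : 0 < x -> abs_pow q x = x `^ q.
Proof.
move=> x0; rewrite /abs_pow; have [->|_] := eqVneq q 0.
  by rewrite gt_eqF// powRr0.
by rewrite gtr0_norm.
Qed.

(** Below this threshold a single star fits in the class. For [q = 0] a nonzero entry has weight 1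
    whatever its size, whence [2 <= r]; otherwise the threshold solves 2 x^q = r, capped at 1/2. *)
Lemma abs_pow_small q r : 0 <= q -> 0 < r -> (q = 0 -> 2 <= r) ->
  exists2 rho : R, 0 < rho <= 2^-1 & forall x, 0 <= x <= rho -> 2 * abs_pow q x <= r.
Proof.
move=> q0 r0 rq0; have [qE|qN0] := eqVneq q 0.
  exists 2^-1; first by rewrite lexx invr_gt0 ltr0n.
  move=> x _; rewrite /abs_pow qE eqxx; apply: le_trans (rq0 qE).
  by rewrite ler_piMr// lern1 leq_b1.
have r20 : 0 < (r / 2) `^ q^-1 by rewrite powR_gt0// divr_gt0.
exists (Num.min 2^-1 ((r / 2) `^ q^-1)).
  by rewrite lt_min ge_min lexx r20 invr_gt0 ltr0n.
move=> x; rewrite le_min => /and3P[x0 _ xr].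
rewrite /abs_pow (negbTE qN0) ger0_norm// mulrC -ler_pdivlMr//.
have := @ge0_ler_powR _ q q0 x ((r / 2) `^ q^-1).
rewrite !nnegrE => /(_ x0 (ltW r20) xr)/le_trans; apply.
by rewrite -powRrM mulVf// powRr1// divr_ge0// ltW.
Qed.

Lemma parametric_lower_bound q r : 0 <= q -> 0 < r -> (q = 0 -> 2 <= r) ->
  exists2 C : R, 0 < C & forall n p, (0 < n)%N -> (1 < p)%N ->
    ((C * (r ^+ 2 / n%:R))%:E <= minimax_risk n p q r)%E.
Proof.
move=> q0 r0 rq0; have [rho /andP[rho0 rho2] small] := abs_pow_small q0 r0 rq0.
(* The squared gap (2 d rho)^2 over 2 (1 + 4) is rho^4 / (10 n), here divided by r^2 / n. *)
exists (rho ^+ 4 / 10 / r ^+ 2); first by rewrite !divr_gt0 ?exprn_gt0.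
move=> n [//|[//|p]] n0 _.
have n1 : 1 <= n%:R :> R by rewrite ler1n.
have np : 0 < n%:R :> R by rewrite ltr0n.
pose s := Num.sqrt (n%:R : R).
have s1 : 1 <= s by rewrite -[1]sqrtr1 ler_wsqrtr.
have s0 : 0 < s by exact: lt_le_trans s1.
have ss : s ^+ 2 = n%:R by rewrite sqr_sqrtr// ltW.
pose d := rho / (2 * s).
have d0 : 0 < d by rewrite divr_gt0// mulr_gt0.
have drho : d <= rho / 2 by rewrite ler_pM2l// lef_pV2 ?posrE ?mulr_gt0// ler_peMr.
have dsq : n%:R * d ^+ 2 = rho ^+ 2 / 4.
  by rewrite /d -ss; field; exact: lt0r_neq0.
pose t := rho - d.
have t0 : 0 < t by rewrite /t; lra.
have t1 : t < 2^-1 by rewrite /t; lra.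
have dE : rho - t = d by rewrite /t; ring.
pose chi := pair_chi t rho.
have sqd : 0 <= d ^+ 2 by exact: sqr_ge0.
have d1 : d ^+ 2 <= 1 / 16.
  apply: (@le_trans _ _ ((1 / 4) ^+ 2)); last by rewrite expr2; lra.
  by rewrite lerXn2r ?nnegrE//; lra.
(* As 0 < t < 1/2, the squared denominators in [pair_chi] are at least 1 and 1/4, and 1 + 4 = 5. *)
have chi_bounds : 1 - 5 * d ^+ 2 <= chi <= 1.
  rewrite /chi /pair_chi dE.
  have a1 : (d / (1 + t)) ^+ 2 <= d ^+ 2.
    rewrite expr_div_n ler_pdivrMr ?exprn_gt0//; last by lra.
    rewrite ler_peMr// expr2; nra.
  have b1 : (d / (1 - t)) ^+ 2 <= 4 * d ^+ 2.
    rewrite expr_div_n ler_pdivrMr ?exprn_gt0//; last by lra.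
    rewrite (_ : 4 * d ^+ 2 * _ = d ^+ 2 * (4 * (1 - t) ^+ 2)); last ring.
    rewrite ler_peMr// expr2; nra.
  have := sqr_ge0 (d / (1 + t)); have := sqr_ge0 (d / (1 - t)).
  move: a1 b1; set a := (d / (1 + t)) ^+ 2; set b := (d / (1 - t)) ^+ 2.
  move=> a1 b1 b0 a0; apply/andP; split; nra.
have /andP[chi_lb chi_ub] := chi_bounds.
have d5 : 0 <= 5 * d ^+ 2 <= 1 by apply/andP; split; lra.
have chi0 : 0 < chi by lra.
(* Bernoulli gives at least 1 - 5 rho^2 / 4, because n d^2 = rho^2 / 4. *)
have chin : 4^-1 <= chi ^+ n.
  apply: (@le_trans _ _ ((1 - 5 * d ^+ 2) ^+ n)); last first.
    by rewrite lerXn2r ?nnegrE//; lra.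
  apply: le_trans (bernoulli_inequality n d5).
  rewrite mulrCA dsq expr2; nra.
have chis : chi <= Num.sqrt chi.
  rewrite -[leLHS](ger0_norm (ltW chi0)) -sqrtr_sqr ler_wsqrtr// expr2.
  by rewrite ler_piMr// ltW.
have V4 : (Num.sqrt chi)^-1 ^+ n <= 4.
  rewrite exprVn -[leRHS]invrK lef_pV2 ?posrE ?exprn_gt0 ?sqrtr_gt0 ?invr_gt0//.
  by apply: le_trans chin _; rewrite lerXn2r ?nnegrE ?sqrtr_ge0// ltW.
(* All other coordinates are attached to one centre; only the first leaf is correlated with it. *)
pose l := fun _ : 'I_p.+1 => ord0 : 'I_1.
pose e := fun _ : 'I_1 => ord0 : 'I_p.+1.
have el : cancel e l by move=> j; rewrite [RHS]ord1.
have risk : (((2 * 1%:R * (rho ^+ 2 - t ^+ 2)) ^+ 2 / (2 * (1 + 4)))%:E <=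
    minimax_risk n (1 + p.+1) q r)%E.
  apply: (@star_minimax_risk _ _ _ l n unit (fun=> e) e t rho q r 4) => //.
  - by apply/andP; split; lra.
  - by apply/andP; split; lra.
  - by rewrite dE gtr0_norm//; lra.
  - by move=> _ _ i; rewrite andbb.
  - by rewrite mul1r small//; apply/andP; split; lra.
  - by rewrite mul1r small//; apply/andP; split; lra.
  - by rewrite card_unit.
  - rewrite (big_pred1 tt); last by case.
    rewrite (big_pred1 tt); last by case.
    by rewrite big_ord1 card_unit expr1n mul1r.
apply: le_trans risk; rewrite lee_fin.
have -> : rho ^+ 4 / 10 / r ^+ 2 * (r ^+ 2 / n%:R) = (2 * (d * rho)) ^+ 2 / (2 * (1 + 4)).
  rewrite /d -ss; field.
  by rewrite !lt0r_neq0.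
rewrite ler_pM2r ?invr_gt0 ?mulr_gt0 ?addr_gt0//.
have h : d * rho <= rho ^+ 2 - t ^+ 2 by rewrite subr_sqr dE ler_pM2l//; lra.
have h0 : 0 < d * rho by exact: mulr_gt0.
rewrite lerXn2r ?nnegrE//; lra.
Qed.

(* The centre j owns the leaves j * b, .., j * b + b - 1, and the prior is uniform
   on {ffun 'I_k -> 'I_b}. *)
Lemma sparse_block_risk (n k b m : nat) (q r rho K : R) :
  (0 < k)%N -> (0 < b)%N -> (k * b <= m)%N -> 0 <= rho < 1 ->
  0 <= r -> 2 * (k%:R * abs_pow q rho) <= r -> 0 < K ->
  (1 + ((1 - rho ^+ 2)^-1 ^+ n - 1) / b%:R) ^+ k <= K ->
  (((2 * k%:R * rho ^+ 2) ^+ 2 / (2 * (1 + K)))%:E <= minimax_risk n (k + m) q r)%E.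
Proof.
case: k => // k _; case: b => // b _ kbm rho01 r0 small K0 hK.
have v0 := onem_sqr_gt0 rho01; have [rho0 rho1] := andP rho01.
have pos_lt (j : 'I_k.+1) (a : 'I_b.+1) : (j * b.+1 + a < m)%N.
  apply: leq_trans kbm; apply: (@leq_trans (j.+1 * b.+1)); last by rewrite leq_mul2r ltn_ord orbT.
  by rewrite mulSn addnC ltn_add2r.
(* [inord] attaches the leaves beyond the last block to centre 0; [e] never chooses them, so their
   loading is 0. *)
pose l := fun i : 'I_m => inord (i %/ b.+1) : 'I_k.+1.
pose e := fun (f : {ffun 'I_k.+1 -> 'I_b.+1}) j => Ordinal (pos_lt j (f j)).
have el f : cancel (e f) l.
  move=> j; apply: val_inj; rewrite /= /l /= divnMDl// divn_small// addn0 inordK//.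
have eE f g j : (e f j == e g j) = (f j == g j).
  by rewrite -val_eqE /= eqn_add2l.
(* Against independence [pair_chi] is a perfect square, which removes the root. *)
have chiE : (Num.sqrt (pair_chi 0 rho))^-1 = (1 - rho ^+ 2)^-1.
  rewrite /pair_chi subr0 addr0 subr0 divr1 -expr2 sqrtr_sqr ger0_norm//; exact: ltW.
have -> : rho ^+ 2 = rho ^+ 2 - 0 ^+ 2 by rewrite expr0n subr0.
apply: (@star_minimax_risk _ _ _ l n _ e (e [ffun=> ord0]) 0 rho q r K) => //.
- by rewrite lexx ltr01.
- by rewrite !subr0 ger0_norm.
- by move=> f g i; rewrite /leaf_weight; do 2 case: ifP.
- rewrite (_ : abs_pow q 0 = 0) ?mulr0//.
  by rewrite /abs_pow eqxx; case: eqP => // /eqP q0'; rewrite normr0 powR0.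
- by rewrite card_ffun !card_ord expn_gt0.
rewrite chiE; set V := (1 - rho ^+ 2)^-1 ^+ n in hK *.
pose w (a a' : 'I_b.+1) := if a == a' then V else 1.
have sumw a : \sum_(a' < b.+1) w a a' = b.+1%:R * (1 + (V - 1) / b.+1%:R).
  rewrite (bigD1 a)//= {1}/w eqxx (eq_bigr (fun=> 1)); last first.
    by move=> i; rewrite /w eq_sym => /negbTE ->.
  rewrite sumr_const cardC1 card_ord /= mulrDr mulr1 mulrCA mulfV ?mulr1 ?pnatr_eq0//.
  by rewrite -[b.+1%:R]natr1; ring.
(* For fixed [f], the sum over [g] factorizes over the blocks; in each block the agreeing choice
   gives [V] and the others 1. *)
rewrite (eq_bigr (fun=> (b.+1%:R * (1 + (V - 1) / b.+1%:R)) ^+ k.+1)); last first.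
  move=> f _; under eq_bigr => g _.
    rewrite -prodrXl (eq_bigr (fun j => w (f j) (g j))); last first.
      by move=> j _; rewrite eE /w; case: eqP => // _; rewrite expr1n.
    over.
  rewrite -(bigA_distr_bigA (fun j a' => w (f j) a')).
  under eq_bigr do rewrite sumw.
  by rewrite prodr_const card_ord.
rewrite sumr_const card_ffun !card_ord exprMn -[leLHS]mulr_natl natrX mulrA -expr2.
by rewrite ler_pM2l// !exprn_gt0// ltr0n.
Qed.

End lower_bounds.

(** Taking [b] one less than [p %/ k] leaves room for the [k] centres. The hypothesis gives [p %/ k]
    at least 2, so that p < (b + 2) k <= 3 b k. *)
Lemma block_size (k p : nat) : (0 < k)%N -> (1 < p)%N -> (k = 1 \/ 2 * k ^ 2 < p)%N ->
  exists b, [/\ 0 < b, k + k * b <= p & p < 3 * (b * k)]%N.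
Proof.
move=> k0 p1 hk; exists (p %/ k).-1.
have d2 : (2 <= p %/ k)%N.
  rewrite leq_divRL//; case: hk => [-> //|hk]; apply: leq_trans (ltnW hk).
  by rewrite leq_mul2l /= expnS expn1 leq_pmulr.
have hd : (k * (p %/ k) <= p)%N by rewrite mulnC leq_divM.
have hu : (p < (p %/ k).+1 * k)%N by exact: ltn_ceil.
case: (p %/ k)%N d2 hd hu => [//|[//|d]] _ hd hu /=.
split=> //; first by rewrite -mulnS.
apply: leq_trans hu _; rewrite mulnA leq_mul2r; apply/orP; right.
by rewrite mulnS !(addSn, mulSn) mul0n; apply: leq_addr.
Qed.

(** * Choice of the parameters for the logarithmic term *)

Section sparse_lower_bound.
Context (R : realType).
Implicit Types q r rho x : R.

Lemma onem_sqr_inv_le_expR rho : 0 <= rho <= 2^-1 ->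
  (1 - rho ^+ 2)^-1 <= expR (2 * rho ^+ 2).
Proof.
move=> /andP[rho0 rho2].
have sq : rho ^+ 2 <= 1 / 4 by rewrite expr2; nra.
have sq0 : 0 <= rho ^+ 2 by exact: sqr_ge0.
apply: le_trans (expR_ge1Dx _); rewrite invf_ple ?posrE; [|lra|lra].
rewrite -[leLHS]mul1r ler_pdivrMr; nra.
Qed.

Lemma half_le_lnD1 x : 2 <= x -> 2^-1 <= ln (x + 1).
Proof.
move=> x2; rewrite -[leLHS]expRK ler_ln ?posrE ?expR_gt0//; last lra.
have : 2^-1 <= expR (- 2^-1) :> R by apply: le_trans (expR_ge1Dx _); lra.
rewrite expRN lef_pV2 ?posrE ?expR_gt0//; lra.
Qed.

Lemma sparse_lower_bound q r : 0 <= q -> q < 2 -> 0 < r -> (q = 0 -> 2 <= r) ->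
  exists2 C : R, 0 < C & forall n p, (0 < n)%N -> (1 < p)%N ->
    r ^+ 2 * n%:R `^ q < (p%:R - 1) / 2 ->
    ((C * Num.min (r ^+ 2 * (ln ((p%:R - 1) / (r ^+ 2 * n%:R `^ q) + 1) /
        (2 * n%:R)) `^ (2 - q)) 1)%:E <= minimax_risk n p q r)%E.
Proof.
move=> q0 q2 r0 rq0; have [rs /andP[rs0 rs2] small] := abs_pow_small q0 r0 rq0.
(* Lower bound of rho^q n^(q/2), from t >= 1 / (4 n); as a factor of [w] it ensures k^2 <= A / 4
   unless k = 1. *)
pose eta := (rs / 2) `^ q.
pose eps := rs ^+ 2.
(* Bounds exp(3 k^2 / A): either k^2 <= A / 4, or k = 1 and A >= r^2, whence the inverse of
   [r ^+ 2]. *)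
pose K := expR (3 * ((r ^+ 2)^-1 + 1)).
have eta0 : 0 < eta by rewrite powR_gt0// divr_gt0.
have eta1 : eta <= 1.
  have <- : (1 : R) `^ q = 1 by rewrite powR1.
  by apply: ge0_ler_powR => //; rewrite ?nnegrE; lra.
have eps0 : 0 < eps by exact: exprn_gt0.
have eps1 : eps <= 1 by rewrite /eps expr_le1// ?ltW//; lra.
have K0 : 0 < K by exact: expR_gt0.
have K10 : 0 < 1 + K by rewrite addr_gt0.
have r20 : 0 < r ^+ 2 by exact: exprn_gt0.
pose c := eta ^+ 2 * eps `^ (2 - q) / (8 * (1 + K)).
have c0 : 0 < c.
  by apply: divr_gt0; [apply: mulr_gt0; [exact: exprn_gt0|exact: powR_gt0]|exact: mulr_gt0].
exists (c * Num.min 1 (r ^+ 2)); first by rewrite mulr_gt0// lt_min ltr01.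
move=> n p n0 p1; set A := r ^+ 2 * n%:R `^ q => hA.
set L := ln _.
have np : 0 < n%:R :> R by rewrite ltr0n.
have n1 : 1 <= n%:R :> R by rewrite ler1n.
have nq1 : 1 <= n%:R `^ q by rewrite -[leLHS](powRr0 n%:R) ler_powR.
have A0 : 0 < A by rewrite mulr_gt0// powR_gt0.
have rA : r ^+ 2 <= A by rewrite ler_peMr// ltW.
have u2 : 2 <= (p%:R - 1) / A by rewrite ler_pdivlMr//; lra.
have L2 : 2^-1 <= L by exact: half_le_lnD1.
pose x := L / (2 * n%:R).
have x0 : 0 < x by rewrite divr_gt0 ?mulr_gt0//; lra.
have xn : (4 * n%:R)^-1 <= x.
  by rewrite /x ler_pdivlMr ?mulr_gt0// invfM -mulrA [_^-1 * (2 * _)]mulrCA mulVf ?gt_eqF//; lra.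
(* The cap at 1 keeps [rho] at most [rs], hence at most 1/2. *)
pose t := Num.min x 1.
have t0 : 0 < t by rewrite lt_min x0 ltr01.
have tx : t <= x by rewrite ge_min lexx.
have t1 : t <= 1 by rewrite ge_min lexx orbT.
have tn : (4 * n%:R)^-1 <= t.
  rewrite le_min xn /= invf_le1 ?mulr_gt0//; lra.
pose rho := rs * Num.sqrt t.
have st1 : Num.sqrt t <= 1 by rewrite -[leRHS]sqrtr1 ler_wsqrtr.
have rho0 : 0 < rho by rewrite mulr_gt0// sqrtr_gt0.
have rhors : rho <= rs by rewrite ler_piMr// ltW.
have rhosq : rho ^+ 2 = eps * t by rewrite exprMn sqr_sqrtr// ltW.
pose sn := Num.sqrt (n%:R : R).
have sn0 : 0 < sn by rewrite sqrtr_gt0.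
have snsn : sn * sn = n%:R by rewrite -expr2 sqr_sqrtr// ltW.
have rhon : rs / 2 <= rho * sn.
  have st : (2 * sn)^-1 <= Num.sqrt t.
    rewrite -[leLHS]ger0_norm ?invr_ge0 ?mulr_ge0 ?(ltW sn0)// -sqrtr_sqr ler_wsqrtr//.
    by rewrite exprVn exprMn [sn ^+ 2]expr2 snsn -natrX.
  rewrite -ler_pdivrMr// -mulrA -invfM; exact: ler_wpM2l (ltW rs0) _ _ st.
have rhoq0 : 0 < rho `^ q by rewrite powR_gt0.
have rhoqr : 2 * rho `^ q <= r by rewrite -abs_pow_powR// small// ltW.
have nqE : n%:R `^ q = (sn `^ q) ^+ 2 by rewrite -snsn powRM ?ltW// expr2.
have rhoqn : eta <= rho `^ q * sn `^ q.
  have <- : (rho * sn) `^ q = rho `^ q * sn `^ q by rewrite powRM ?ltW.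
  rewrite /eta; apply: ge0_ler_powR => //; rewrite ?nnegrE.
    by rewrite divr_ge0// ltW.
  by rewrite mulr_ge0// ltW.
(* The number of centres allowed by the budget [r], reduced by the factor [eta]. If it is below 1, a
   single centre is used, which fits by [rhoqr]. *)
pose w := eta * r / (2 * rho `^ q).
have w0 : 0 < w by rewrite divr_gt0 ?mulr_gt0.
pose k := maxn 1 (Num.truncn w).
have k0 : (0 < k)%N by rewrite leq_max.
have /andP[wl wu] := truncn_itv (ltW w0).
have kw2 : w / 2 <= k%:R.
  rewrite /k; move: wu; case: (Num.truncn w) => [|u] wu; first by rewrite maxn0; lra.
  rewrite (maxn_idPr _)//; have := ler0n R u.
  by move: wu; rewrite -[u.+2%:R]natr1 -[u.+1%:R]natr1 => wu u0; lra.
have k1w : k = 1%N \/ k%:R <= w.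
  rewrite /k; move: wl; case: (Num.truncn w) => [|u] wl; first by left.
  by right; rewrite (maxn_idPr _).
have ksmall : 2 * (k%:R * abs_pow q rho) <= r.
  rewrite abs_pow_powR//; case: k1w => [->|kw]; first by rewrite mul1r.
  rewrite mulrCA -ler_pdivlMr ?mulr_gt0//.
  apply: le_trans kw _; rewrite /w ler_pM2r ?invr_gt0 ?mulr_gt0//.
  by rewrite ler_piMl// ltW.
have k1A : k = 1%N \/ k%:R ^+ 2 <= A / 4.
  case: k1w => [->|kw]; [by left|right].
  have wA : w <= r * sn `^ q / 2.
    rewrite /w ler_pdivrMr ?mulr_gt0//.
    rewrite (_ : r * _ / 2 * _ = rho `^ q * sn `^ q * r); last by field.
    by rewrite ler_pM2r.
  have -> : A / 4 = (r * sn `^ q / 2) ^+ 2 by rewrite /A nqE; field.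
  rewrite lerXn2r ?nnegrE//; first by rewrite divr_ge0 ?mulr_ge0 ?powR_ge0// ltW.
  exact: le_trans kw wA.
have kA : k%:R ^+ 2 <= A * ((r ^+ 2)^-1 + 1).
  rewrite mulrDr mulr1; case: k1A => [->|kA]; last first.
    apply: le_trans kA _; apply: (@le_trans _ _ A); first lra.
    by rewrite lerDr mulr_ge0 ?invr_ge0 ?ltW.
  rewrite expr1n; apply: (@le_trans _ _ (A / r ^+ 2)); first by rewrite ler_pdivlMr// mul1r.
  by rewrite lerDl ltW.
have kp : (k = 1 \/ 2 * k ^ 2 < p)%N.
  case: k1A => [->|kA']; [by left|right].
  rewrite -(ltr_nat R) natrM natrX; lra.
have [b [b0 kbp pbk]] := block_size k0 p1 kp.
have bp : 0 < b%:R :> R by rewrite ltr0n.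
have pE : p = (k + (p - k))%N by rewrite subnKC// (leq_trans _ kbp)// leq_addr.
have kbm : (k * b <= p - k)%N by rewrite leq_subRL// (leq_trans _ kbp)// leq_addr.
have rho01 : 0 <= rho < 1 by rewrite ltW//=; lra.
have rho02 : 0 <= rho <= 2^-1 by rewrite ltW//=; lra.
(* By the choice of [rho], 2 n rho^2 <= 2 n x = L, and e^L is the argument of the logarithm. *)
have VL : (1 - rho ^+ 2)^-1 ^+ n <= (p%:R - 1) / A + 1.
  apply: (@le_trans _ _ (expR (2 * rho ^+ 2) ^+ n)).
    rewrite lerXn2r ?nnegrE ?expR_ge0 ?onem_sqr_inv_le_expR//.
    by rewrite invr_ge0 ltW// onem_sqr_gt0.
  rewrite -expRM_natl -[leRHS]lnK ?posrE; last lra.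
  rewrite ler_expR -/L rhosq.
  have : eps * t <= x by apply: le_trans tx; rewrite ler_piMl// ltW.
  by rewrite /x ler_pdivlMr ?mulr_gt0// => h; lra.
have V1 : 1 <= (1 - rho ^+ 2)^-1 ^+ n.
  rewrite exprn_ege1// invf_ge1 ?onem_sqr_gt0//.
  by rewrite lerBlDr lerDl sqr_ge0.
have chi : (1 + ((1 - rho ^+ 2)^-1 ^+ n - 1) / b%:R) ^+ k <= K.
  set y := _ / b%:R.
  have y0 : 0 <= y by rewrite divr_ge0 ?subr_ge0.
  have yb : y <= 3 * k%:R / A.
    rewrite /y ler_pdivrMr//; apply: (@le_trans _ _ ((p%:R - 1) / A)); first lra.
    rewrite mulrAC ler_pM2r ?invr_gt0//.
    have : p%:R <= 3 * (b%:R * k%:R) :> R by rewrite -!natrM ler_nat ltnW.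
    lra.
  apply: (@le_trans _ _ (expR y ^+ k)).
    by rewrite lerXn2r ?nnegrE ?expR_ge0 ?addr_ge0// expR_ge1Dx.
  rewrite -expRM_natl ler_expR.
  apply: (@le_trans _ _ (k%:R * (3 * k%:R / A))); first by rewrite ler_wpM2l.
  rewrite (_ : k%:R * _ = 3 * (k%:R ^+ 2 / A)); last by field; rewrite gt_eqF.
  by rewrite ler_pM2l// ler_pdivrMr// mulrC.
have := sparse_block_risk k0 b0 kbm rho01 (ltW r0) ksmall K0 chi.
rewrite -pE; apply: le_trans; rewrite lee_fin.
set X := r ^+ 2 * _.
have X0 : 0 <= X by rewrite mulr_ge0 ?powR_ge0// ltW.
(* For x <= 1 the power of [t] is that of the rate; for x > 1 it is 1 and [r ^+ 2] remains, whence
   the factor [Num.min 1 (r ^+ 2)] in the constant. *)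
have hM : Num.min 1 (r ^+ 2) * Num.min X 1 <= r ^+ 2 * t `^ (2 - q).
  have m0 : 0 <= Num.min X 1 by rewrite le_min X0 ler01.
  rewrite /t; case: (leP x 1) => x1.
    apply: (@le_trans _ _ (Num.min X 1)); first by rewrite ler_piMl// ge_min lexx.
    by rewrite ge_min lexx.
  rewrite powR1; apply: ler_pM => //.
  - by rewrite le_min ler01 ltW.
  - by rewrite ge_min lexx orbT.
  - by rewrite ge_min lexx orbT.
(* Splitting rho^4 as (rho^2)^(2-q) (rho^q)^2 isolates the exponent of the rate; the second factor
   cancels the denominator of [w]. *)
have rhopow : (rho ^+ 2) ^+ 2 = (eps `^ (2 - q) * t `^ (2 - q)) * (rho `^ q) ^+ 2.
  rewrite -powRM ?ltW// -rhosq [(rho `^ q) ^+ 2]expr2 -powRM ?ltW// -expr2.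
  rewrite -powRD; last by apply/implyP => _; rewrite gt_eqF// exprn_gt0.
  by rewrite subrK powR_mulrn// sqr_ge0.
have wk : w * rho ^+ 2 <= 2 * k%:R * rho ^+ 2.
  by rewrite ler_pM2r ?exprn_gt0// mulrC -ler_pdivrMr.
have wsq : (w * rho ^+ 2) ^+ 2 = eta ^+ 2 * r ^+ 2 / 4 * (eps `^ (2 - q) * t `^ (2 - q)).
  rewrite exprMn rhopow /w; field; exact: lt0r_neq0.
have wk2 : (w * rho ^+ 2) ^+ 2 <= (2 * k%:R * rho ^+ 2) ^+ 2.
  have wr0 : 0 <= w * rho ^+ 2 by rewrite mulr_ge0 ?sqr_ge0// ltW.
  by rewrite lerXn2r ?nnegrE//; exact: le_trans wk.
have KK : 0 < (2 * (1 + K))^-1 by rewrite invr_gt0 mulr_gt0.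
rewrite -[leLHS]mulrA; apply: le_trans (ler_wpM2l (ltW c0) hM) _.
apply: le_trans (ler_wpM2r (ltW KK) wk2).
rewrite wsq /c le_eqVlt; apply/orP; left; apply/eqP; field.
by rewrite gt_eqF.
Qed.

End sparse_lower_bound.

Unset Implicit Arguments.

(* For q = 0 and r < 2 the class is {I_p} by [sparse_corr0_lt2], so the minimax
   risk is 0 while the rate is at least r^2 / n; this case is excluded. *)
Theorem theorem3p2 (R : realType) (q r : R)
    (q_ge0 : 0 <= q) (q_lt2 : q < 2) (r_gt0 : 0 < r)
    (r_q0 : q = 0 -> 2 <= r) :
  exists2 C3 : R, 0 < C3 &
    forall n p : nat, (0 < n)%N -> (0 < p)%N ->
      2 * ln (p%:R : R) < n%:R ->
      r ^+ 2 < (p%:R - 1) * n%:R `^ (- q) / 2 ->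
      (C3%:E * phi_rate n p q r <= minimax_risk n p q r)%E.
Proof.
have [C1 C10 h1] := parametric_lower_bound q_ge0 r_gt0 r_q0.
have [C2 C20 h2] := sparse_lower_bound q_ge0 q_lt2 r_gt0 r_q0.
exists (Num.min C1 C2); first by rewrite lt_min C10.
move=> n p n0 p0 _; have np : 0 < n%:R :> R by rewrite ltr0n.
rewrite powRN mulrAC ltr_pdivlMr ?powR_gt0// => hA.
have p1 : (1 < p)%N.
  rewrite -(ltr_nat R) -subr_gt0 -(pmulr_lgt0 _ (_ : 0 < 2^-1)) ?invr_gt0//.
  by apply: le_lt_trans hA; rewrite mulr_ge0 ?sqr_ge0 ?powR_ge0.
have {}h1 := h1 n p n0 p1; have {}h2 := h2 n p n0 p1 hA.
rewrite /phi_rate; set a := r ^+ 2 / n%:R in h1 *; set b := r ^+ 2 * _ in h2 *.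
(* The rate is at most the maximum of [a] and [Num.min b 1], the quantities that [h1] and [h2]
   control. *)
apply: (@le_trans _ _ ((Num.min C1 C2)%:E * (Num.max a (Num.min b 1))%:E)%E).
  apply: lee_wpmul2l; first by rewrite lee_fin le_min !ltW.
  rewrite ge_max lee_fin le_max lexx/=.
  apply: (@le_trans _ _ (Num.min b 1)%:E); last by rewrite lee_fin le_max lexx orbT.
  by rewrite EFin_min le_min !ge_min !lexx ?orbT.
have a0 : 0 <= a by rewrite divr_ge0 ?sqr_ge0 ?ltW.
have b0 : 0 <= Num.min b 1 by rewrite le_min ler01 mulr_ge0 ?sqr_ge0 ?powR_ge0.
rewrite -EFinM; case: (leP a (Num.min b 1)) => _.
  by apply: le_trans h2; rewrite lee_fin ler_wpM2r// ge_min lexx orbT.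
by apply: le_trans h1; rewrite lee_fin ler_wpM2r// ge_min lexx.
Qed.
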